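(* Let $D$ be a Borel data structure with $\mathrm{SYM}(D)\neq\emptyset$. Then $\mathrm{eSYM}(D)$ is a non-empty measurable subset of $\mathrm{SYM}(D)$, and the map $$\mathscr{P}(\mathrm{eSYM}(D))\longrightarrow \mathrm{SYM}(D),\qquad \Xi\longmapsto E[\Xi],$$ is a bijection, where $E[\Xi]$ is the rule $a\mapsto E[\Xi]_a\in\mathscr{P}(D_a)$ defined by $$E[\Xi]_a(\cdot)=\int_{\mathrm{eSYM}(D)}\mu_a(\cdot)\,d\Xi(\mu).$$
   Context: A Borel space is a measurable space admitting a bi-measurable bijection onto a Borel subset of $[0,1]$. For a measurable space $\mathcal{X}$, $\mathscr{P}(\mathcal{X})$ is the set of probability measures on $\mathcal{X}$. A Borel data structure (BDS) $D$ is a rule mapping every finite set $a$ to a Borel space $D_a$ and every injection $\tau:b\to a$ between finite sets to a measurable map $D[\tau]:D_a\to D_b$, with $D[\mathrm{id}_a]=\mathrm{id}_{D_a}$ and $D[\sigma\circ\tau]=D[\tau]\circ D[\sigma]$ for composable injections (a contravariant functor from finite sets with injections to Borel spaces with measurable maps). ''Rules'' defined on all finite sets are understood in NBG with global choice (alternatively, inside a fixed Grothendieck universe). An exchangeable law on $D$ is a rule $\mu$ sending every finite set $a$ to $\mu_a\in\mathscr{P}(D_a)$ such that $\mu_a\circ D[\tau]^{-1}=\mu_b$ for every injection $\tau:b\to a$ between finite sets. $\mathrm{SYM}(D)$ is the set of exchangeable laws on $D$ (it is determined by set-many data), equipped with the $\sigma$-field generated by the evaluation maps $\mu\mapsto\mu_a(M)\in[0,1]$,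 $a$ finite, $M\subseteq D_a$ measurable. For $b\subseteq a$, $\iota_{b,a}:b\to a$ is the inclusion. $\mu\in\mathrm{SYM}(D)$ has the independence property if for all finite sets $a,b$ with $a\cap b=\emptyset$, writing $a+b=a\cup b$, $$\mu_{a+b}\circ(D[\iota_{a,a+b}],D[\iota_{b,a+b}])^{-1}=\mu_a\otimes\mu_b.$$ $\mathrm{eSYM}(D)\subseteq\mathrm{SYM}(D)$ is the subset of exchangeable laws with the independence property. *)

(* Defs.v *)
From HB Require Import structures.
From mathcomp Require Import all_boot all_order all_algebra.
From mathcomp Require Import finmap.
From mathcomp Require Import all_classical all_reals all_analysis.
From mathcomp Require Import measurable_realfun.

Set Implicit Arguments.
Unset Strict Implicit.
Unset Printing Implicit Defensive.

Import Order.TTheory GRing.Theory Num.Theory.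
Import numFieldNormedType.Exports.

Local Open Scope classical_set_scope.
Local Open Scope ring_scope.
Local Open Scope ereal_scope.

(* A [probability T R] is a function on all of [set T], constrained only on
   measurable sets, so one probability measure has many Leibniz-distinct
   representations.  [Prob T R] is the set of probability measures on T proper:
   it keeps the unique representative that is 0 off the sigma-algebra. *)
Record Prob d (T : measurableType d) (R : realType) := MkProb {
  prob_val :> probability T R;
  prob_out : forall A : set T, ~ measurable A -> prob_val A = 0
}.

Lemma Prob_ext d (T : measurableType d) (R : realType) (P Q : Prob T R) :
  (forall A, measurable A -> P A = Q A) -> P = Q.
Proof.
move=> PQ.
have {PQ}e : prob_val P = prob_val Q :> (set T -> \bar R).
  apply/funext => A; have [mA|mA] := pselect (measurable A); first exact: PQ.
  by rewrite !prob_out.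
have {e} : prob_val P = prob_val Q.
  case: (prob_val P) (prob_val Q) e => [f cf] [g cg] /= e.
  rewrite e in cf *; congr (Probability.Pack _).
  case: cf cg => [[a1 a2] [a3] [a4] [a5] [a6] [a7] [a8]].
  case=> [[b1 b2] [b3] [b4] [b5] [b6] [b7] [b8]].
  rewrite (Prop_irrelevance a1 b1) (Prop_irrelevance a2 b2).
  rewrite (Prop_irrelevance a3 b3) (Prop_irrelevance a4 b4).
  rewrite (Prop_irrelevance a5 b5) (Prop_irrelevance a6 b6).
  by rewrite (Prop_irrelevance a7 b7) (Prop_irrelevance a8 b8).
by case: P Q => [p hp] [q hq] /= e; subst q; congr MkProb; exact: Prop_irrelevance.
Qed.

Section trim.
Context d (T : measurableType d) (R : realType) (P : probability T R).

Definition trim (A : set T) : \bar R := if `[< measurable A >] then P A else 0.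

Lemma trimE A : measurable A -> trim A = P A.
Proof. by move=> mA; rewrite /trim asboolT. Qed.

Let trim0 : trim set0 = 0.
Proof. by rewrite trimE// measure0. Qed.

Let trim_ge0 A : 0 <= trim A.
Proof. by rewrite /trim; case: ifP. Qed.

Let trim_sigma_additive : semi_sigma_additive trim.
Proof.
move=> F mF tF mUF; rewrite trimE//.
under eq_fun do under eq_bigr do rewrite trimE//.
exact: measure_semi_sigma_additive.
Qed.

HB.instance Definition _ :=
  isMeasure.Build _ _ _ trim trim0 trim_ge0 trim_sigma_additive.

Let trimT : trim setT = 1.
Proof. by rewrite trimE// probability_setT. Qed.

HB.instance Definition _ := Measure_isProbability.Build _ _ _ trim trimT.

Lemma trim_out A : ~ measurable A -> trim A = 0.
Proof. by move=> mA; rewrite /trim asboolF. Qed.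

Definition to_Prob : Prob T R := MkProb trim_out.

End trim.

(* B is Borel in R and contained in [0, 1]; measurability of the inverse
   B -> T is expressed by images of measurable sets being Borel. *)
Definition borel_space (R : realType) d (T : measurableType d) : Prop :=
  exists (B : set (measurableTypeR R)) (f : T -> measurableTypeR R),
    [/\ measurable B, B `<=` [set x : R | (0 <= x <= 1)%R],
        set_bij [set: T] B f, measurable_fun [set: T] f
      & forall A : set T, measurable A -> measurable (f @` A)].

(* "All finite sets" do not form a type, and indexing by [finType] would put the
   space of exchangeable laws above the universe of [measurableType].  As in a
   fixed universe of sets, U is an ambient collection, meant to be infinite, and
   a finite set is a finite subset of U; intersections, unions and inclusions
   are then the literal ones.
   A [measurableType] is inhabited, which costs nothing here: a space carrying
   a probability measure is non-empty. *)
Record bds (R : realType) (U : choiceType) := Bds {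
  bds_disp : {fset U} -> measure_display;
  bds_obj :> forall a : {fset U}, measurableType (bds_disp a);
  bds_borel : forall a : {fset U}, borel_space R (bds_obj a);
  bds_map : forall (b a : {fset U}) (tau : b -> a),
    injective tau -> bds_obj a -> bds_obj b;
  bds_map_measurable : forall (b a : {fset U}) (tau : b -> a)
    (tau_inj : injective tau), measurable_fun setT (bds_map tau_inj);
  bds_map_id : forall (a : {fset U}) (x : bds_obj a),
    bds_map (@inj_id a) x = x;
  bds_map_comp : forall (c b a : {fset U}) (sigma : b -> a) (tau : c -> b)
    (sigma_inj : injective sigma) (tau_inj : injective tau) (x : bds_obj a),
    bds_map (inj_comp sigma_inj tau_inj) x = bds_map tau_inj (bds_map sigma_inj x)
}.

Arguments bds_map {R U} _ {b a tau} _ _.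

Section exchangeable_laws.
Context (R : realType) (U : choiceType) (D : bds R U).

Record exch_law := ExchLaw {
  law_at :> forall a : {fset U}, Prob (D a) R;
  law_exch : forall (b a : {fset U}) (tau : b -> a) (tau_inj : injective tau)
    (M : set (D b)), measurable M ->
    pushforward (law_at a) (bds_map D tau_inj) M = law_at b M
}.

Lemma exch_law_ext (mu nu : exch_law) :
  (forall a (M : set (D a)), measurable M -> mu a M = nu a M) -> mu = nu.
Proof.
move=> h; have {h} e : law_at mu = law_at nu.
  by apply: functional_extensionality_dep => a; apply: Prob_ext => M /h.
by case: mu nu e => [m hm] [n hn] /= e; subst n; congr ExchLaw; exact: Prop_irrelevance.
Qed.

Definition restriction (b a : {fset U}) (ba : (b `<=` a)%fset) : D a -> D b :=
  bds_map D (@fincl_inj _ _ _ ba).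

Definition independence_property (mu : exch_law) : Prop :=
  forall a b : {fset U}, (a `&` b)%fset = fset0 ->
  forall M : set (D a * D b), measurable M ->
    pushforward (mu (a `|` b)%fset)
      (fun x => (restriction (fsubsetUl a b) x, restriction (fsubsetUr a b) x)) M
    = (mu a \x mu b) M.

Definition eSYM : set exch_law := [set mu | independence_property mu].

Definition evaluation_preimages : set (set exch_law) :=
  \bigcup_(a in [set: {fset U}]) \bigcup_(M in @measurable _ (D a))
    preimage_set_system setT (fun mu : exch_law => mu a M) measurable.

(* Copies of [exch_law] and of the subset [eSYM], each indexed by a proof of
   non-emptiness because [measurableType] requires a distinguished point. *)
Definition exch_law_pt (ne : [set: exch_law] !=set0) : Type := exch_law.
Definition eSYM_pt (ene : eSYM !=set0) : Type := set_type eSYM.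

Section pointed.
Variables (ne : [set: exch_law] !=set0) (ene : eSYM !=set0).

HB.instance Definition _ := gen_eqMixin (exch_law_pt ne).
HB.instance Definition _ := gen_choiceMixin (exch_law_pt ne).
HB.instance Definition _ := isPointed.Build (exch_law_pt ne) (projT1 (cid ne)).

HB.instance Definition _ := gen_eqMixin (eSYM_pt ene).
HB.instance Definition _ := gen_choiceMixin (eSYM_pt ene).
HB.instance Definition _ := isPointed.Build (eSYM_pt ene)
  (exist (fun mu => mu \in eSYM) _ (mem_set (projT2 (cid ene)))).

End pointed.

Definition SYM_space (ne : [set: exch_law] !=set0) : measurableType _ :=
  g_sigma_algebraType (evaluation_preimages : set (set (exch_law_pt ne))).

Section mixture.
Variables (ne : [set: exch_law] !=set0) (ene : eSYM !=set0).

Definition eSYM_incl (mu : eSYM_pt ene) : SYM_space ne := set_val mu.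

(* trace sigma-algebra *)
Definition eSYM_space : measurableType _ :=
  g_sigma_algebra_preimageType eSYM_incl.

Definition eSYM_law (mu : eSYM_space) : exch_law := set_val (mu : eSYM_pt ene).

Lemma measurable_SYM_eval (a : {fset U}) (M : set (D a)) : measurable M ->
  measurable_fun [set: SYM_space ne] (fun mu : SYM_space ne => (mu : exch_law) a M).
Proof.
move=> mM _ B mB; apply: sub_sigma_algebra.
by exists a => //; exists M => //; exists B.
Qed.

Lemma measurable_eSYM_eval (a : {fset U}) (M : set (D a)) : measurable M ->
  measurable_fun [set: eSYM_space] (fun mu : eSYM_space => eSYM_law mu a M).
Proof.
move=> mM _ B mB; rewrite setTI.
have := measurable_SYM_eval mM measurableT mB; rewrite setTI => mE.
by exists ((fun mu : SYM_space ne => (mu : exch_law) a M) @^-1` B); rewrite ?setTI.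
Qed.

Section mixture_at.
Variables (Xi : probability eSYM_space R) (a : {fset U}).

Definition mixture_fun (M : set (D a)) : \bar R :=
  \int[Xi]_(mu in [set: eSYM_space]) eSYM_law mu a M.

Let mixture0 : mixture_fun set0 = 0.
Proof. by rewrite /mixture_fun integral0_eq// => mu _; rewrite measure0. Qed.

Let mixture_ge0 M : 0 <= mixture_fun M.
Proof. by apply: integral_ge0 => mu _; exact: measure_ge0. Qed.

Let mixture_sigma_additive : semi_sigma_additive mixture_fun.
Proof.
move=> F mF tF mUF; rewrite /mixture_fun.
rewrite [X in _ --> X](_ : _ =
    \sum_(n <oo) \int[Xi]_(mu in [set: eSYM_space]) eSYM_law mu a (F n)); last first.
  rewrite -integral_nneseries//; last by move=> n; exact: measurable_eSYM_eval.
  apply: eq_integral => mu _.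
  by apply/esym/cvg_lim => //; exact: measure_semi_sigma_additive.
by apply: is_cvg_nneseries => n _ _; exact: integral_ge0.
Qed.

HB.instance Definition _ :=
  isMeasure.Build _ _ _ mixture_fun mixture0 mixture_ge0 mixture_sigma_additive.

Let mixtureT : mixture_fun setT = 1.
Proof.
rewrite /mixture_fun (eq_integral (cst 1)).
  by rewrite integral_cst// mul1e; exact: probability_setT.
by move=> mu _; exact: probability_setT.
Qed.

HB.instance Definition _ := Measure_isProbability.Build _ _ _ mixture_fun mixtureT.

Definition mixture_at : Prob (D a) R := to_Prob mixture_fun.

Lemma mixture_atE (M : set (D a)) : measurable M ->
  mixture_at M = \int[Xi]_(mu in [set: eSYM_space]) eSYM_law mu a M.
Proof. exact: trimE. Qed.

End mixture_at.

Lemma mixture_exch (Xi : probability eSYM_space R) (b a : {fset U})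
    (tau : b -> a) (tau_inj : injective tau) (M : set (D b)) : measurable M ->
  pushforward (mixture_at Xi a) (bds_map D tau_inj) M = mixture_at Xi b M.
Proof.
move=> mM; rewrite /pushforward !mixture_atE//; last first.
  by rewrite -[X in measurable X]setTI; exact: bds_map_measurable.
by apply: eq_integral => mu _; exact: law_exch.
Qed.

Definition mixture (Xi : Prob eSYM_space R) : exch_law :=
  ExchLaw (@mixture_exch Xi).

End mixture.
End exchangeable_laws.

Arguments eSYM {R U} D.
Arguments evaluation_preimages {R U} D.
Arguments mixture {R U D ne ene} Xi.

(* Main.v *)
(* Idea.  An exchangeable law is determined by its restriction to the finite
   subsets of a sequence e 0, e 1, ... of distinct points of U, arranged in
   infinitely many disjoint columns.  Under an exchangeable law the columns form
   an exchangeable sequence, so the frequency with which an event occurs in the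
   columns converges almost surely; the limit frequencies are a random element
   of eSYM, whose law Xi satisfies E[Xi] = mu.  That the limit is exchangeable
   and independent is a matter of second moments, since the expectation of a
   product of limit frequencies is the probability of the joint event in distinct
   columns.  The only random source needed is the interval [0, 1[: nested
   intervals carry any sequence of binary events with prescribed joint laws, and
   quantile functions turn the limit frequencies of {code <= q}, q rational, into
   measures.  Conversely, on eSYM the evaluations mu |-> mu_a(M) are closed under
   products (independence on disjoint copies of a and b), so that Xi is determined
   by the integrals of the evaluations, that is by E[Xi]. *)

Require Import Defs.
From HB Require Import structures.
From mathcomp Require Import all_boot all_order all_algebra.
From mathcomp Require Import finmap.
From mathcomp Require Import all_classical all_reals all_analysis.
From mathcomp Require Import measurable_realfun.
From mathcomp Require Import ring lra.

Set Implicit Arguments.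
Unset Strict Implicit.
Unset Printing Implicit Defensive.

Import Order.TTheory GRing.Theory Num.Theory.
Import numFieldNormedType.Exports.

Local Open Scope classical_set_scope.
Local Open Scope ring_scope.

(** * Expectations of bounded functions *)

(** An exchangeable law gives a family of finite-sample laws, and no space on which all columns are
    observed at once. Borel codes reduce the data to countably many events {code <= q in column c},
    which is what lets the unit interval serve as such a space. Almost sure statements must likewise
    rest on countably many conditions, so identities between measures are first reduced to rational
    rays of the code and finite lists of positions. All computations pass through one function of a
    list of events, [columns_prob]: the probability that they occur in distinct columns. It does not
    depend on the columns, and the directing measures lam satisfy E[prod lam(t)] = [columns_prob] l.
    If an event t on one sample splits into parts at disjoint positions, t and the list of its parts
    are interchangeable in [columns_prob], so E[(lam(t) - prod lam(parts))^2] = 0: exchangeability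
    is the case of one part, independence that of two. For uniqueness, a class closed under products
    has to reach the whole sigma-algebra; multipliers do this, since they form an algebra by
    construction. *)

Lemma prodr_in01 (R : realType) I (r : seq I) (P : pred I) (F : I -> R) :
  (forall i, 0 <= F i <= 1) -> 0 <= \prod_(i <- r | P i) F i <= 1.
Proof.
move=> F01; apply: (big_ind (fun y => 0 <= y <= 1)) => [|x y /andP[x0 x1] /andP[y0 y1]|//].
  by rewrite ler01 lexx.
by rewrite mulr_ge0// mulr_ile1.
Qed.

Section image_law.
Context d d' (T : measurableType d) (T' : measurableType d') (R : realType).
Variables (P : probability T R) (X : T -> T').

Definition image_law (mX : measurable_fun [set: T] X) : probability T' R :=
  distribution P (HB.pack_for {mfun T >-> T'} X (isMeasurableFun.Build _ _ _ _ X mX)).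

Lemma image_lawE (mX : measurable_fun [set: T] X) A :
  image_law mX A = P (X @^-1` A).
Proof. by []. Qed.

End image_law.

Section bounded_expectation.
Context d (T : measurableType d) (R : realType).
Implicit Types (f g : T -> R) (A : set T).

(** Boundedness makes a function integrable for every probability, so that linearity and limits of
    [Ex] carry no integrability conditions and the notion does not mention [P]. *)
Definition bmf f := measurable_fun [set: T] f /\ exists M, forall x, `|f x| <= M.

Lemma bmf_cst c : bmf (fun=> c).
Proof. by split; [exact: measurable_cst|exists `|c|]. Qed.

Lemma bmfD f g : bmf f -> bmf g -> bmf (fun x => f x + g x).
Proof.
move=> [mf [M fM]] [mg [N gN]]; split; first exact: measurable_funD.
by exists (M + N) => x; apply: le_trans (ler_normD _ _) _; exact: lerD.
Qed.

Lemma bmfM f g : bmf f -> bmf g -> bmf (fun x => f x * g x).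
Proof.
move=> [mf [M fM]] [mg [N gN]]; split; first exact: measurable_funM.
by exists (M * N) => x; rewrite normrM; exact: ler_pM.
Qed.

Lemma bmfN f : bmf f -> bmf (fun x => - f x).
Proof.
move=> [mf [M fM]]; split; first exact: measurableT_comp.
by exists M => x; rewrite normrN.
Qed.

Lemma bmfB f g : bmf f -> bmf g -> bmf (fun x => f x - g x).
Proof. by move=> bf bg; apply: bmfD => //; exact: bmfN. Qed.

Lemma bmf_norm f : bmf f -> bmf (fun x => `|f x|).
Proof.
move=> [mf [M fM]]; split; first exact: measurableT_comp.
by exists M => x; rewrite normr_id.
Qed.

Lemma bmf_indic A : measurable A -> bmf (\1_A : T -> R).
Proof.
move=> mA; split; first exact: measurable_indic.
by exists 1 => x; rewrite indicE ger0_norm// lern1 leq_b1.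
Qed.

Lemma bmf01 f : measurable_fun [set: T] f -> (forall x, 0 <= f x <= 1) -> bmf f.
Proof.
by move=> mf f01; split => //; exists 1 => x; case/andP: (f01 x) => *; rewrite ger0_norm.
Qed.

Lemma bmf_sum I (r : seq I) (F : I -> T -> R) :
  (forall i, bmf (F i)) -> bmf (fun x => \sum_(i <- r) F i x).
Proof.
move=> bF; elim: r => [|i r IH].
  by under eq_fun do rewrite big_nil; exact: bmf_cst.
by under eq_fun do rewrite big_cons; exact: bmfD.
Qed.

Lemma bmf_prod I (r : seq I) (F : I -> T -> R) :
  (forall i, bmf (F i)) -> bmf (fun x => \prod_(i <- r) F i x).
Proof.
move=> bF; elim: r => [|i r IH].
  by under eq_fun do rewrite big_nil; exact: bmf_cst.
by under eq_fun do rewrite big_cons; exact: bmfM.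
Qed.

Lemma bmf_lim (F : (T -> R)^nat) f M : (forall n, measurable_fun [set: T] (F n)) ->
  (forall n x, `|F n x| <= M) -> (forall x, F ^~ x @ \oo --> f x) -> bmf f.
Proof.
move=> mF FM Ff; split.
  by apply: (measurable_fun_cvg mF) => x _; exact: Ff.
by exists M => x; apply: (cvgr_to_le (cvg_norm (Ff x))); exact: nearW.
Qed.

(** The conclusion is [bmf (f \o h)] unfolded: inside this section [bmf] is tied to [T], while
    [f \o h] lives on [T']. *)
Lemma bmf_comp d' (T' : measurableType d') (h : T' -> T) f :
  measurable_fun [set: T'] h -> bmf f ->
  measurable_fun [set: T'] (f \o h) /\ exists M, forall x, `|(f \o h) x| <= M.
Proof.
move=> mh [mf [M fM]]; split; first exact: measurableT_comp.
by exists M => x; exact: fM.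
Qed.

Variable P : probability T R.

Definition Ex f : R := \int[P]_x f x.

Lemma bmf_integrable f : bmf f -> P.-integrable setT (EFin \o f).
Proof.
move=> [mf [M fM]]; apply: measurable_bounded_integrable => //.
  by rewrite (le_lt_trans (probability_le1 P _))// ltry.
exists M; split; first by rewrite num_real.
by move=> N MN x _; exact: (le_trans (fM x) (ltW MN)).
Qed.

Lemma ExE f : bmf f -> (Ex f)%:E = (\int[P]_x (f x)%:E)%E.
Proof. by move=> bf; rewrite /Ex /Rintegral fineK//; exact/integrable_fin_num/bmf_integrable. Qed.

Lemma eq_Ex f g : (forall x, f x = g x) -> Ex f = Ex g.
Proof. by move=> fg; congr Ex; apply/funext. Qed.

Lemma Ex_cst c : Ex (fun=> c) = c.
Proof. by rewrite /Ex Rintegral_cst//= probability_setT mulr1. Qed.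

Lemma ExD f g : bmf f -> bmf g -> Ex (fun x => f x + g x) = Ex f + Ex g.
Proof. by move=> bf bg; apply: RintegralD => //; exact: bmf_integrable. Qed.

Lemma ExB f g : bmf f -> bmf g -> Ex (fun x => f x - g x) = Ex f - Ex g.
Proof. by move=> bf bg; apply: RintegralB => //; exact: bmf_integrable. Qed.

Lemma ExZ c f : bmf f -> Ex (fun x => c * f x) = c * Ex f.
Proof. by move=> bf; apply: RintegralZl => //; exact: bmf_integrable. Qed.

Lemma Ex_sum I (r : seq I) (F : I -> T -> R) : (forall i, bmf (F i)) ->
  Ex (fun x => \sum_(i <- r) F i x) = \sum_(i <- r) Ex (F i).
Proof.
move=> bF; elim: r => [|i r IH].
  by under eq_Ex do rewrite big_nil; rewrite Ex_cst big_nil.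
under eq_Ex do rewrite big_cons.
by rewrite ExD// ?IH ?big_cons//; exact: bmf_sum.
Qed.

Lemma Ex_ge0 f : (forall x, 0 <= f x) -> 0 <= Ex f.
Proof. by move=> f0; apply: Rintegral_ge0. Qed.

Lemma le_Ex f g : bmf f -> bmf g -> (forall x, f x <= g x) -> Ex f <= Ex g.
Proof. by move=> bf bg fg; apply: le_Rintegral => //; exact: bmf_integrable. Qed.

Lemma Ex_indic A : measurable A -> (Ex (\1_A))%:E = P A.
Proof. by move=> mA; rewrite ExE ?integral_indic ?setIT//; exact: bmf_indic. Qed.

Lemma fine_prob A : measurable A -> fine (P A) = Ex (\1_A).
Proof. by move=> mA; rewrite -Ex_indic. Qed.

Lemma Ex_cvg (F : (T -> R)^nat) f M : (forall n, measurable_fun [set: T] (F n)) ->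
  (forall n x, `|F n x| <= M) -> bmf f ->
  {ae P, forall x, F ^~ x @ \oo --> f x} -> Ex (F n) @[n --> \oo] --> Ex f.
Proof.
move=> mF FM bf Ff.
have bF n : bmf (F n) by split => //; exists M.
apply: (@fine_cvg _ _ _ _ (fun n => \int[P]_x (F n x)%:E)%E).
suff [_ _] : [/\ P.-integrable setT (EFin \o f),
  [sequence \int[P]_x `|(EFin \o F n) x - (EFin \o f) x|]_n%E @ \oo --> 0%E &
  [sequence \int[P]_x (EFin \o F n) x]_n%E @ \oo --> (\int[P]_x (EFin \o f) x)%E].
  by rewrite ExE.
apply: (@dominated_convergence _ _ _ P setT measurableT
  (fun n => EFin \o F n) (EFin \o f) (cst M%:E)).
- by move=> n; exact/measurable_EFinP.
- by apply/measurable_EFinP; case: bf.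
- by apply: filterS Ff => x Fx _; apply/cvg_EFin => //; exact: nearW.
- exact: (bmf_integrable (bmf_cst M)).
- by apply: aeW => x n _ /=; rewrite lee_fin.
Qed.

Lemma Ex_cvgT (F : (T -> R)^nat) f M : (forall n, measurable_fun [set: T] (F n)) ->
  (forall n x, `|F n x| <= M) ->
  (forall x, F ^~ x @ \oo --> f x) -> Ex (F n) @[n --> \oo] --> Ex f.
Proof.
move=> mF FM Ff; apply: (Ex_cvg mF FM (bmf_lim mF FM Ff)).
exact: aeW.
Qed.

Lemma Ex_eq0_ae f : bmf f -> (forall x, 0 <= f x) -> Ex f = 0 ->
  {ae P, forall x, f x = 0}.
Proof.
move=> bf f0 Ef0.
have mEf : measurable_fun setT (EFin \o f) by apply/measurable_EFinP; case: bf.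
have [h _] := @ae_eq_integral_abs _ _ _ P setT measurableT _ mEf.
have /h : (\int[P]_x `|(EFin \o f) x| = 0)%E.
  under eq_integral do rewrite /= ger0_norm//.
  by rewrite -ExE// Ef0.
by apply: filterS => x /(_ I)[].
Qed.

End bounded_expectation.

Section image_expectation.
Context d d' (T : measurableType d) (T' : measurableType d') (R : realType).
Variables (P : probability T R) (X : T -> T').

Lemma Ex_image_law (mX : measurable_fun [set: T] X) (f : T' -> R) : bmf f ->
  Ex (image_law P mX) f = Ex P (f \o X).
Proof.
move=> bf; rewrite /Ex /Rintegral; congr fine.
rewrite /image_law integral_distribution//.
  by apply/measurable_EFinP; case: bf.
exact: (bmf_integrable P (bmf_comp mX bf)).
Qed.

End image_expectation.

(** * Probabilities agreeing on a multiplicative class *)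

Section sign_iteration.
Context (R : realType).
Implicit Types h y : R.

(** The Newton-Schulz iteration, with fixed points -1, 0 and 1. Every iterate is a polynomial in
    [h], so the sign of [g - c], and with it the indicator of [c < g], is a bounded pointwise limit
    of polynomials in [g]. *)
Fixpoint sgn_iter h n : R :=
  if n is n.+1 then sgn_iter h n * (3 - sgn_iter h n ^+ 2) / 2 else h.

Lemma sgn_iterN h n : sgn_iter (- h) n = - sgn_iter h n.
Proof. by elim: n => //= n ->; rewrite sqrrN !mulNr. Qed.

Lemma sgn_iter0 n : sgn_iter 0 n = 0.
Proof. by elim: n => //= n ->; rewrite !mul0r. Qed.

(** One step multiplies the gap 1 - y by (1 - y)(2 + y)/2 = 1 - y/2 - y^2/2, which is at most 1 -
    h/2 as long as y >= h. The iterates therefore stay above [h] and the gap decays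
    geometrically. *)
Lemma sgn_iter_bound h n : 0 <= h <= 1 ->
  h <= sgn_iter h n <= 1 /\ 1 - sgn_iter h n <= (1 - h / 2) ^+ n.
Proof.
move=> /andP[h0 h1]; elim: n => [|n [/andP[hy y1] ye]] /=.
  by rewrite expr0 lexx h1; split => //; lra.
set y := sgn_iter h n in hy y1 ye *.
have e : 1 - y * (3 - y ^+ 2) / 2 = (1 - y) * ((1 - y) * (2 + y) / 2) by field.
have y0 : 0 <= y by exact: le_trans hy.
have b0 : 0 <= (1 - y) * (2 + y) / 2 by rewrite divr_ge0// mulr_ge0//; lra.
have b1 : (1 - y) * (2 + y) / 2 <= 1 - h / 2 by nra.
split; last first.
  by rewrite e exprSr; apply: ler_pM => //; lra.
apply/andP; split; first by nra.
by rewrite -subr_ge0 e mulr_ge0//; lra.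
Qed.

Lemma sgn_iter_norm h n : `|h| <= 1 -> `|sgn_iter h n| <= 1.
Proof.
move=> h1; have [h0|h0] := leP 0 h.
  have [/andP[a b] _] := @sgn_iter_bound h n (introT andP (conj h0 (le_trans (ler_norm _) h1))).
  by rewrite ger0_norm//; exact: le_trans a.
have h01 : 0 <= - h <= 1.
  by rewrite oppr_ge0 (ltW h0)/=; apply: le_trans h1; rewrite ltr0_norm.
have [/andP[a b] _] := @sgn_iter_bound _ n h01.
have /andP[nh0 _] := h01.
by rewrite -[h]opprK sgn_iterN normrN ger0_norm//; exact: le_trans a.
Qed.

Lemma sgn_iter_cvg_pos h : 0 < h -> h <= 1 -> sgn_iter h @ \oo --> (1 : R).
Proof.
move=> h0 h1.
have b n := @sgn_iter_bound h n (introT andP (conj (ltW h0) h1)).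
have geo : (fun n => 1 - (1 - h / 2) ^+ n) @ \oo --> (1 : R).
  rewrite -[X in _ --> X]subr0; apply: cvgB; first exact: cvg_cst.
  by apply: cvg_expr; rewrite ger0_norm; lra.
apply: (@squeeze_cvgr _ _ _ _ (fun n => 1 - (1 - h / 2) ^+ n) (cst 1)) => //; last exact: cvg_cst.
by apply: nearW => n /=; have [/andP[_ ->]] := b n; rewrite andbT lerBlDl -lerBlDr.
Qed.

Lemma sgn_iter_cvg h : `|h| <= 1 -> sgn_iter h @ \oo --> Num.sg h.
Proof.
have [->|h0|h0] := sgrP h => h1.
- by rewrite (_ : sgn_iter 0 = cst 0); [exact: cvg_cst|apply/funext => n; rewrite sgn_iter0].
- by apply: sgn_iter_cvg_pos => //; exact: (le_trans (ler_norm _) h1).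
- rewrite (_ : sgn_iter h = fun n => - sgn_iter (- h) n); last first.
    by apply/funext => n; rewrite sgn_iterN opprK.
  apply: cvgN; apply: sgn_iter_cvg_pos; first by rewrite oppr_gt0.
  exact: h1.
Qed.

End sign_iteration.

Section multiplicative_class.
Context d (T : measurableType d) (R : realType) (P Q : probability T R).
Variable G : set (T -> R).
Hypothesis bG : forall g, G g -> bmf g.
Hypothesis G1 : G (fun=> 1).
Hypothesis GM : forall f g, G f -> G g -> G (fun x => f x * g x).
Hypothesis PQ : forall g, G g -> Ex P g = Ex Q g.

Let H (f : T -> R) := bmf f /\
  forall g, G g -> Ex P (fun x => f x * g x) = Ex Q (fun x => f x * g x).

(** [H] is a vector space closed under bounded limits, with no reason to be closed under products.
    Its multipliers are closed under products by construction, inherit sums and limits from [H], and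
    contain [G] because [G] is multiplicative. *)
Definition mult_closure (u : T -> R) := bmf u /\ forall f, H f -> H (fun x => f x * u x).

Let K := mult_closure.

Lemma mult_closure_cst c : K (fun=> c).
Proof.
split=> [|f [bf Hf]]; first exact: bmf_cst.
split=> [|g Gg]; first by apply: bmfM => //; exact: bmf_cst.
have e x : f x * c * g x = c * (f x * g x) by ring.
by rewrite !(eq_Ex _ e) !ExZ ?Hf//; apply: bmfM => //; exact: bG.
Qed.

Lemma mult_closureM u v : K u -> K v -> K (fun x => u x * v x).
Proof.
move=> [bu Ku] [bv Kv]; split; first exact: bmfM.
move=> f /Ku/Kv; suff -> : (fun x => f x * u x * v x) = (fun x => f x * (u x * v x)) by [].
by apply/funext => x; rewrite mulrA.
Qed.

Lemma mult_closureD u v : K u -> K v -> K (fun x => u x + v x).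
Proof.
move=> [bu Ku] [bv Kv]; split; first exact: bmfD.
move=> f Hf; have [bfu fu] := Ku _ Hf; have [bfv fv] := Kv _ Hf.
split; first by apply: bmfM; [case: Hf|exact: bmfD].
move=> g Gg; have bg := bG Gg.
have e x : f x * (u x + v x) * g x = f x * u x * g x + f x * v x * g x by ring.
by rewrite !(eq_Ex _ e) !ExD ?fu ?fv//; apply: bmfM => //.
Qed.

Lemma mult_closure_gen g : G g -> K g.
Proof.
move=> Gg; split=> [|f [bf Hf]]; first exact: bG.
split=> [|g' Gg']; first by apply: bmfM => //; exact: bG.
have e x : f x * g x * g' x = f x * (g x * g' x) by ring.
by rewrite !(eq_Ex _ e); exact/Hf/GM.
Qed.

Lemma mult_closure_lim (F : (T -> R)^nat) u M : (forall n, K (F n)) ->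
  (forall n x, `|F n x| <= M) -> (forall x, F ^~ x @ \oo --> u x) -> K u.
Proof.
move=> KF FM Fu; have mF n : measurable_fun setT (F n) by case: (KF n) => -[].
have bu := bmf_lim mF FM Fu; split => // f [bf Hf].
split=> [|g Gg]; first exact: bmfM.
have bg := bG Gg; have [mfg [N fgN]] := bmfM bf bg.
have cv (S : probability T R) :
    Ex S (fun x => f x * F n x * g x) @[n --> \oo] --> Ex S (fun x => f x * u x * g x).
  apply: (@Ex_cvgT _ _ _ _ _ _ (N * M)).
  - by move=> n; apply: measurable_funM; [apply: measurable_funM|]; case: bf bg => ? ? [].
  - by move=> n x; rewrite mulrAC normrM; exact: ler_pM.
  - by move=> x; apply: cvgMl; apply: cvgMr; exact: Fu.
have := cv P; rewrite (_ : (fun n => _) = fun n => Ex Q (fun x => f x * F n x * g x)).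
  by move=> /(cvg_unique (@norm_hausdorff _ _)); apply; exact: cv.
apply/funext => n; have [_ KFn] := KF n.
by have [_ ->] := KFn f (conj bf Hf).
Qed.

Lemma mult_closure_sgn_iter u n : K u -> K (fun x => sgn_iter (u x) n).
Proof.
move=> Ku; elim: n => //= n IH.
have -> : (fun x => sgn_iter (u x) n * (3 - sgn_iter (u x) n ^+ 2) / 2) =
    (fun x => sgn_iter (u x) n * (3 + (-1) * (sgn_iter (u x) n * sgn_iter (u x) n)) * 2^-1).
  by apply/funext => x; rewrite expr2 mulN1r.
apply: mult_closureM; last exact: mult_closure_cst.
apply: mult_closureM => //; apply: mult_closureD; first exact: mult_closure_cst.
by apply: mult_closureM; [exact: mult_closure_cst|exact: mult_closureM].
Qed.

Lemma mult_closure_gt g c : K g -> K (\1_[set x | c < g x]).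
Proof.
move=> Kg; have [mg [M gM]] := Kg.1.
have M0 : 0 <= `|M| by [].
have k0 : 0 < `|M| + `|c| + 1 by rewrite ltr_wpDl// addr_ge0.
set k := `|M| + `|c| + 1 in k0.
(* A rescaling of g - c with the same sign and values in [-1, 1], where [sgn_iter] converges; the
   summand 1 keeps [k] positive. *)
pose h x := k^-1 * (g x + - c).
have Kh : K h.
  apply: mult_closureM; first exact: mult_closure_cst.
  by apply: mult_closureD => //; exact: mult_closure_cst.
have h1 x : `|h x| <= 1.
  rewrite /h normrM normfV (gtr0_norm k0) ler_pdivrMl// mulr1.
  rewrite (le_trans (ler_normB _ _))// /k.
  by have := gM x; have := ler_norm M; lra.
have Ks : K (fun x => Num.sg (h x)).
  apply: (@mult_closure_lim (fun n x => sgn_iter (h x) n) _ 1).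
  - by move=> n; exact: mult_closure_sgn_iter.
  - by move=> n x; exact: sgn_iter_norm.
  - by move=> x; exact: sgn_iter_cvg.
(* For s in {-1, 0, 1}, (s^2 + s)/2 is the indicator of s = 1. *)
have -> : \1_[set x | c < g x] =
    (fun x => 2^-1 * (Num.sg (h x) * Num.sg (h x) + Num.sg (h x))).
  apply/funext => x; rewrite indicE; have -> : Num.sg (h x) = Num.sg (g x - c).
    by rewrite /h sgrM (gtr0_sg (x := k^-1)) ?invr_gt0// mul1r.
  case: sgrP => [/eqP|gc|gc].
  - by rewrite subr_eq0 => /eqP <-; rewrite memNset ?mulr0 ?addr0 ?mulr0//= ltxx.
  - rewrite mem_set; last by rewrite /= -subr_gt0.
    by rewrite mulr1 mulVf.
  - rewrite memNset; last by move=> /= ?; lra.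
    by rewrite mulrN1 opprK subrr mulr0.
apply: mult_closureM; first exact: mult_closure_cst.
by apply: mult_closureD => //; exact: mult_closureM.
Qed.

Lemma mult_closure_sigma_algebra :
  sigma_algebra setT [set A | measurable A /\ K (\1_A)].
Proof.
split => [|A [mA KA]|F SF].
- split => //; rewrite indic0; exact: mult_closure_cst.
- split; first exact: measurableD.
  have -> : \1_(setT `\` A) = (fun x => 1 + (-1) * (\1_A x)) :> (T -> R).
    apply/funext => x; rewrite mulN1r !indicE in_setD in_setT/=.
    by case: (x \in A); rewrite ?subrr ?subr0.
  apply: mult_closureD; first exact: mult_closure_cst.
  by apply: mult_closureM => //; exact: mult_closure_cst.
have mF n : measurable (F n) by case: (SF n).
split; first exact: bigcupT_measurable.
(* The indicator of the points outside F 0, ..., F (n - 1), as a product; it tends to the indicator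
   of the complement of the union. *)
pose u n (x : T) : R := \prod_(i < n) (1 + (-1) * (\1_(F i) x)).
have Ku n : K (u n).
  rewrite /u; elim: n => [|n IH].
    by under eq_fun do rewrite big_ord0; exact: mult_closure_cst.
  under eq_fun do rewrite big_ord_recr/=.
  apply: mult_closureM => //; apply: mult_closureD; first exact: mult_closure_cst.
  by apply: mult_closureM; [exact: mult_closure_cst|by case: (SF n)].
have f01 i x : 1 + (-1) * (\1_(F i) x) = (x \notin F i)%:R :> R.
  by rewrite mulN1r indicE; case: (x \in F i); rewrite ?subrr ?subr0.
have -> : \1_(\bigcup_i F i) = (fun x => 1 + (-1) * (1 + (-1) * \1_(\bigcup_i F i) x)) :> (T -> R).
  by apply/funext => x; ring.
apply: mult_closureD; first exact: mult_closure_cst.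
apply: mult_closureM; first exact: mult_closure_cst.
apply: (@mult_closure_lim u _ 1) => //.
- move=> n x; have /andP[u0 u1] : 0 <= u n x <= 1.
    by apply: prodr_in01 => i; rewrite f01 ler0n lern1 leq_b1.
  by rewrite ger0_norm.
- move=> x; have [[i _ Fix]|nF] := pselect ((\bigcup_i F i) x).
    rewrite indicE mem_set; last by exists i.
    rewrite mulr1 subrr; apply: cvg_near_cst; exists i.+1 => // n /= ni.
    apply/eqP; rewrite /u; apply/prodf_eq0; exists (Ordinal ni) => //=.
    by rewrite f01 mem_set.
  rewrite indicE memNset// mulr0 addr0; apply: cvg_near_cst; apply: nearW => n.
  rewrite /u big1// => i _; rewrite f01 memNset// => Fi.
  by apply: nF; exists i.
Qed.

(** The constant 1 lies in [H] by [PQ], so the multiplier \1_A sends it to an element of [H], namely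
    \1_A; testing against the constant 1 of [G] gives the equality. *)
Lemma mult_closure_eq A : measurable A -> K (\1_A) -> P A = Q A.
Proof.
move=> mA [_ KA].
have H1 : H (fun=> 1).
  by split=> [|g Gg]; [exact: bmf_cst|rewrite !(eq_Ex _ (fun=> mul1r _)); exact: PQ].
have [_ /(_ _ G1)] := KA _ H1.
under eq_Ex do rewrite mul1r mulr1; under [RHS]eq_Ex do rewrite mul1r mulr1.
by move=> e; rewrite -!Ex_indic// e.
Qed.

End multiplicative_class.

(** * Binary processes on the unit interval *)

Section uniform_law.
Context (R : realType).

Let mu01 : set (measurableTypeR R) -> \bar R :=
  mrestr (@lebesgue_measure R) (measurable_itv `[0, 1[).

HB.instance Definition _ := Measure.on mu01.

Let mu01T : mu01 setT = 1%E.
Proof.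
by rewrite /mu01 /mrestr setTI lebesgue_measure_itv/= lte_fin ltr01 oppr0 adde0.
Qed.

HB.instance Definition _ := Measure_isProbability.Build _ _ _ mu01 mu01T.

Definition unif01 : probability (measurableTypeR R) R := mu01.

(** Only the trace of [A] on [0, 1[ is prescribed, because the events to be measured are preimages
    under [clip] and may contain points outside [0, 1[. *)
Lemma unif01_itv (a b : R) (A : set R) : 0 <= a -> a <= b -> b <= 1 ->
  A `&` `[0, 1[ = [set` `[a, b[] -> unif01 A = (b - a)%:E.
Proof.
move=> a0 ab b1 e; rewrite /unif01/= /mu01 /mrestr e.
rewrite lebesgue_measure_itv/= lte_fin; case: ltP => //= ba.
by rewrite (@le_anti _ _ a b) ?subrr// ab.
Qed.

End uniform_law.

Section patterns.
Context d (T : measurableType d) (R : realType) (P : probability T R).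
Implicit Types (A : nat -> set T) (s : seq bool).

Definition pattern A (n : nat) (x : T) : seq bool := mkseq (fun i => `[<A i x>]) n.

Lemma patternS A n x : pattern A n.+1 x = rcons (pattern A n x) `[<A n x>].
Proof. by rewrite /pattern mkseqS. Qed.

Lemma size_pattern A n x : size (pattern A n x) = n.
Proof. exact: size_mkseq. Qed.

Lemma measurable_pattern A n s : (forall i, measurable (A i)) ->
  measurable [set x | pattern A n x = s].
Proof.
move=> mA; have [sn|sn] := eqVneq (size s) n; last first.
  rewrite (_ : mkset _ = set0)// -subset0 => x /= xs.
  by move: sn; rewrite -xs size_pattern eqxx.
rewrite (_ : mkset _ = \bigcap_(i in `I_n)
    (if nth false s i then A i else ~` A i)); last first.
  apply/seteqP; split=> [x /= xs i /= il|x /= h].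
    by rewrite -xs nth_mkseq//; case: asboolP.
  apply: (@eq_from_nth _ false); first by rewrite size_pattern sn.
  move=> i; rewrite size_pattern => il; have := h i il.
  by rewrite nth_mkseq//; case: (nth false s i) => Ai; [rewrite asboolT|rewrite asboolF].
by apply: bigcap_measurableType => i _; case: ifP => _ //; exact: measurableC.
Qed.

Lemma Ex_pattern A n (f : seq bool -> R) : (forall i, measurable (A i)) ->
  Ex P (fun x => f (pattern A n x)) =
  \sum_(t : n.-tuple bool) f t * fine (P [set x | pattern A n x = t]).
Proof.
move=> mA.
have e x : f (pattern A n x) =
    \sum_(t : n.-tuple bool) f t * \1_[set x | pattern A n x = t] x.
  rewrite (bigD1 (Tuple (introT eqP (size_pattern A n x))))//= big1 => [|t tx].
    by rewrite addr0 indicE mem_set// mulr1.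
  rewrite indicE memNset ?mulr0//= => xt; move/eqP: tx; apply.
  exact: val_inj.
rewrite (eq_Ex _ e) Ex_sum => [|t].
  apply: eq_bigr => t _; rewrite ExZ ?fine_prob//.
    exact: measurable_pattern.
  by apply: bmf_indic; exact: measurable_pattern.
apply: bmfM; first exact: bmf_cst.
by apply: bmf_indic; exact: measurable_pattern.
Qed.

End patterns.

(** * Words coded by nested intervals *)

Section nested_intervals.
Context (R : realType) (w : seq bool -> R).
Hypothesis w_nil : w [::] = 1.
Hypothesis w_ge0 : forall s, 0 <= w s.
Hypothesis w_cons : forall s, w s = w (false :: s) + w (true :: s).

(* Words are read from right to left: the head is the latest letter. *)
Fixpoint left_end (s : seq bool) : R :=
  if s is b :: s' then left_end s' + (if b then w (false :: s') else 0) else 0.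

Definition word_itv (s : seq bool) : set R := `[left_end s, left_end s + w s[.

(** For x in [0, 1[ this is the word of length n whose interval contains x ([word_at_itv]), and the
    only one ([word_itv_at]). *)
Fixpoint word_at (x : R) n : seq bool :=
  if n is n.+1 then (left_end (true :: word_at x n) <= x) :: word_at x n else [::].

Lemma size_word_at x n : size (word_at x n) = n.
Proof. by elim: n => //= n ->. Qed.

Lemma left_end_bound s : 0 <= left_end s /\ left_end s + w s <= 1.
Proof.
elim: s => [|b s [IH0 IH1]] /=; first by rewrite w_nil add0r.
have wf := w_ge0 (false :: s); have wt := w_ge0 (true :: s).
by rewrite w_cons in IH1; case: b; split; lra.
Qed.

Lemma word_at_itv x n : 0 <= x < 1 -> word_itv (word_at x n) x.
Proof.
move=> x01; elim: n => [|n IH] /=.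
  by rewrite /word_itv/= in_itv/= w_nil add0r.
move: IH; rewrite /word_itv /= !in_itv/=; set s := word_at x n => /andP[IH0 IH1].
rewrite w_cons in IH1.
by have [h|h] := leP (left_end s + w (false :: s)) x; apply/andP; split => //; lra.
Qed.

Lemma word_itv_at x s : word_itv s x -> word_at x (size s) = s.
Proof.
elim: s => //= b s IH; rewrite /word_itv/= in_itv/= => /andP[h0 h1].
have wf := w_ge0 (false :: s); have wt := w_ge0 (true :: s).
have e : word_at x (size s) = s.
  by apply: IH; rewrite /word_itv/= in_itv/= w_cons; case: b h0 h1 => h0 h1;
    apply/andP; split; lra.
rewrite e; congr cons; case: b h0 h1 => [//|] h0 h1.
by apply/negbTE; rewrite -ltNge; lra.
Qed.

(** Points outside [0, 1[ are sent to 0, so that every real has a word of each length and the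
    statements below hold at every point rather than almost everywhere. *)
Definition clip (x : measurableTypeR R) : measurableTypeR R :=
  if x \in `[0, 1[ then x else 0.

Lemma clip01 x : 0 <= clip x < 1.
Proof. by rewrite /clip; case: ifPn; rewrite ?in_itv//= lexx ltr01. Qed.

Lemma measurable_clip : measurable_fun setT clip.
Proof.
apply: measurable_fun_ifT => //.
apply: (measurable_fun_bool true); rewrite setTI.
rewrite (_ : _ @^-1` _ = `[0, 1[%classic)//; exact: measurable_itv.
Qed.

Definition word_event n : set (measurableTypeR R) :=
  [set x | left_end (true :: word_at (clip x) n) <= clip x].

Lemma word_at_pattern n x : word_at (clip x) n = rev (pattern word_event n x).
Proof.
elim: n => //= n IH; rewrite patternS rev_rcons -IH; congr cons.
by apply/idP/asboolP.
Qed.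

Lemma word_at_preimage s :
  [set x | word_at (clip x) (size s) = s] = clip @^-1` word_itv s.
Proof.
apply/seteqP; split=> x /=; last exact: word_itv_at.
by move=> e; rewrite -[X in word_itv X]e; exact/word_at_itv/clip01.
Qed.

Lemma measurable_word_at n s : measurable [set x | word_at (clip x) n = s].
Proof.
have [<-|sn] := eqVneq (size s) n; last first.
  rewrite (_ : mkset _ = set0)// -subset0 => x /= xs.
  by move: sn; rewrite -xs size_word_at eqxx.
rewrite word_at_preimage -[X in measurable X]setTI.
by apply: measurable_clip => //; exact: measurable_itv.
Qed.

Lemma measurable_word_event n : measurable (word_event n).
Proof.
rewrite (_ : word_event n = \bigcup_(t : n.-tuple bool)
    ([set x | word_at (clip x) n = t] `&` clip @^-1` `[left_end (true :: t), +oo[)).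
  apply: fin_bigcup_measurable => // t _; apply: measurableI.
    exact: measurable_word_at.
  by rewrite -[X in measurable X]setTI; apply: measurable_clip => //; exact: measurable_itv.
apply/seteqP; split=> x /=.
  move=> h; exists (Tuple (introT eqP (size_word_at (clip x) n))) => //=.
  by split => //; rewrite in_itv/= andbT.
by move=> [t _ [/= <-]]; rewrite in_itv/= andbT.
Qed.

Lemma unif01_word s : unif01 R [set x | word_at (clip x) (size s) = s] = (w s)%:E.
Proof.
rewrite word_at_preimage; have [l0 l1] := left_end_bound s.
rewrite (@unif01_itv _ (left_end s) (left_end s + w s))//.
- by congr EFin; ring.
- by rewrite lerDl.
rewrite /word_itv; apply/seteqP; split=> x /=.
  by rewrite /clip => -[]; case: ifP.
rewrite !in_itv/= => /andP[h0 h1].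
by split; [rewrite /clip ifT ?in_itv//=; apply/andP; split => //|apply/andP; split]; lra.
Qed.

End nested_intervals.

Section binary_process.
Context (R : realType) (d : nat -> measure_display) (T : forall N, measurableType (d N)).
Variables (p : forall N, probability (T N) R) (A : forall N, nat -> set (T N)).
Arguments A : clear implicits.
Hypothesis mA : forall N i, measurable (A N i).
Hypothesis A_consistent : forall N s,
  p N.+1 [set x | pattern (A N.+1) N x = s] = p N [set x | pattern (A N) N x = s].

(** The reversal is there because words put the latest letter first and patterns put it last. *)
Let w s := fine (p (size s) [set x | pattern (A (size s)) (size s) x = rev s]).

Let w_nil : w [::] = 1.
Proof.
rewrite /w /= (_ : mkset _ = setT) ?probability_setT//.
by apply/seteqP; split.
Qed.

Let w_ge0 s : 0 <= w s.
Proof. by apply: fine_ge0; exact: measure_ge0. Qed.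

Let w_cons s : w s = w (false :: s) + w (true :: s).
Proof.
rewrite /w/= -fineD ?fin_num_measure//; [|exact: measurable_pattern..].
congr fine; rewrite -A_consistent !rev_cons -measureU//; [|exact: measurable_pattern..|].
  congr (p _ _); apply/seteqP; split=> x /=.
    by rewrite patternS => ->; case: asboolP => _; [right|left].
  by rewrite patternS => -[] /rcons_inj[].
by rewrite -subset0 => x /= [->] /rcons_inj[].
Qed.

(** The last clause holds at every point: a word of mass 0 has an empty half-open interval and is
    never read. Relations between the events that hold at all points of the spaces [T N] thus pass
    to [E] without an exceptional set. *)
Lemma binary_process : exists E : nat -> set (measurableTypeR R),
  [/\ forall n, measurable (E n),
      forall N (f : seq bool -> R),
        Ex (unif01 R) (fun x => f (pattern E N x)) = Ex (p N) (fun x => f (pattern (A N) N x))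
    & forall N x, exists y, pattern (A N) N y = pattern E N x].
Proof.
have mE := measurable_word_event w_nil w_ge0 w_cons.
exists (word_event w); split=> [n|N f|N x]; first exact: mE.
  rewrite !Ex_pattern//.
  apply: eq_bigr => t _; congr (_ * _).
  have -> : [set x | pattern (word_event w) N x = t] =
      [set x | word_at w (clip x) (size (rev t)) = rev t].
    rewrite size_rev size_tuple; apply/seteqP; split=> x /=.
      by rewrite word_at_pattern => ->.
    by rewrite word_at_pattern => /(can_inj revK).
  by rewrite unif01_word//= /w revK size_rev size_tuple.
have := word_at_itv w_nil w_cons N (clip01 x).
rewrite /word_itv/= in_itv/= => /andP[l0 l1].
have w0 : 0 < w (word_at w (clip x) N) by lra.
move: w0; rewrite /w size_word_at word_at_pattern revK => w0.
apply/not_existsP => h; move: w0; rewrite (_ : mkset _ = set0) ?measure0 ?ltxx//.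
by rewrite -subset0 => y /= /h.
Qed.

End binary_process.

(** * Exchangeable laws on initial segments of the integers *)

Section finite_injections.
Implicit Types (phi psi : nat -> nat) (n N K : nat).

Definition embeds phi n N :=
  (forall i, (i < n)%N -> (phi i < N)%N) /\
  (forall i j, (i < n)%N -> (j < n)%N -> phi i = phi j -> i = j).

Lemma embeds_id n N : (n <= N)%N -> embeds id n N.
Proof. by move=> nN; split=> [i /leq_trans|//]; exact. Qed.

Lemma uniq_mkseqP phi n : uniq (mkseq phi n) ->
  forall i j, (i < n)%N -> (j < n)%N -> phi i = phi j -> i = j.
Proof.
move=> u i j il jl e; apply/eqP.
by rewrite -(nth_uniq 0%N _ _ u) ?size_mkseq// !nth_mkseq// e.
Qed.

Lemma injective_mkseq_uniq phi n :
  (forall i j, (i < n)%N -> (j < n)%N -> phi i = phi j -> i = j) -> uniq (mkseq phi n).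
Proof.
move=> h; rewrite map_inj_in_uniq ?iota_uniq// => i j.
by rewrite !mem_iota !add0n/=; exact: h.
Qed.

Lemma extend_injection (r : seq nat) (h : nat -> nat) : {in r &, injective h} ->
  exists2 h', injective h' & {in r, h' =1 h}.
Proof.
move=> hI; pose B := (\max_(x <- r) h x).+1.
have hB x : x \in r -> (h x < B)%N by move=> xr; rewrite ltnS; exact: leq_bigmax_seq.
(* Arguments outside [r] are sent to [B] and beyond, above every value of [h] on [r]. *)
exists (fun x => if x \in r then h x else (B + x)%N) => [x y|x -> //].
case: ifPn => xr; case: ifPn => yr.
- exact: hI.
- by move=> e; have := hB _ xr; rewrite e ltnNge leq_addr.
- by move=> e; have := hB _ yr; rewrite -e ltnNge leq_addr.
- exact: addnI.
Qed.

End finite_injections.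

(* The finite sets {0, ..., n - 1} with their injections; a Borel space is a
   measurable retract of the real line through a code with values in [0, 1]. *)
Record nat_bds (R : realType) := NatBds {
  nat_disp : nat -> measure_display;
  nat_obj :> forall n, measurableType (nat_disp n);
  nat_map : (nat -> nat) -> forall n N, nat_obj N -> nat_obj n;
  nat_map_measurable : forall phi n N, embeds phi n N ->
    measurable_fun setT (@nat_map phi n N);
  nat_map_id : forall n x, @nat_map id n n x = x;
  nat_map_comp : forall phi psi n N K x, embeds phi n N -> embeds psi N K ->
    nat_map phi n (nat_map psi N x) = @nat_map (psi \o phi) n K x;
  nat_map_ext : forall phi psi n N x, (forall i, (i < n)%N -> phi i = psi i) ->
    nat_map phi n x = @nat_map psi n N x;
  nat_code : forall n, nat_obj n -> R;
  nat_decode : forall n, R -> nat_obj n;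
  nat_code_measurable : forall n, measurable_fun setT (@nat_code n);
  nat_decode_measurable : forall n, measurable_fun setT (@nat_decode n : measurableTypeR R -> _);
  nat_codeK : forall n x, nat_decode n (@nat_code n x) = x;
  nat_code01 : forall n x, 0 <= @nat_code n x <= 1
}.

Arguments nat_map {R} _ phi n N x : rename.
Arguments nat_code {R} _ n x : rename.
Arguments nat_decode {R} _ n y : rename.

Record nat_exch (R : realType) (X : nat_bds R) := NatExch {
  nat_law :> forall n, probability (X n) R;
  nat_law_map : forall phi n N (M : set (X n)), embeds phi n N -> measurable M ->
    nat_law N (nat_map X phi n N @^-1` M) = nat_law n M
}.

Lemma eq_Ex_measure d (T : measurableType d) (R : realType) (P Q : probability T R) f :
  (forall A, measurable A -> P A = Q A) -> Ex P f = Ex Q f.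
Proof.
move=> PQ; rewrite /Ex /Rintegral; congr fine.
by apply: eq_measure_integral => A mA _; exact: PQ.
Qed.

(** * Joint probabilities of events read at given positions *)

Section cylinders.
Context (R : realType) (X : nat_bds R).

(** Size, event and measurability are bundled so that one list can mix events on samples of
    different sizes. *)
Record item := Item {
  item_size : nat;
  item_set : set (X item_size);
  item_measurable : measurable item_set }.

Arguments item_set : clear implicits.

(* (M, phi) stands for the event that the sample read along phi lies in M. *)
Definition cylinder := (item * (nat -> nat))%type.

Implicit Types (c : cylinder) (L : seq cylinder) (l : seq item).

Definition cyl_support c := mkseq c.2 (item_size c.1).
Definition support L := flatten (map cyl_support L).
Definition shift (h : nat -> nat) c : cylinder := (c.1, h \o c.2).
Definition sup_support L := \max_(x <- support L) x.+1.

Definition cyl_val N c (x : X N) : R :=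
  \1_(item_set c.1) (nat_map X c.2 (item_size c.1) N x).
Definition cyls_val N L (x : X N) : R := \prod_(c <- L) cyl_val c x.

(** Each map is injective, but different cylinders may overlap. This suffices for measurability, and
    it covers lists that read one column several times, for which [uniq (support L)] fails. *)
Definition inj_cyls L := all (fun c => uniq (cyl_support c)) L.

Lemma support_cons c L : support (c :: L) = cyl_support c ++ support L.
Proof. by []. Qed.

Lemma support_cat L L' : support (L ++ L') = support L ++ support L'.
Proof. by rewrite /support map_cat flatten_cat. Qed.

Lemma uniq_support_inj L : uniq (support L) -> inj_cyls L.
Proof. by elim: L => //= c L IH; rewrite cat_uniq => /and3P[-> _ /IH]. Qed.

Lemma sup_support_cons c L N : (sup_support (c :: L) <= N)%N ->
  all (fun x => x < N)%N (cyl_support c) /\ (sup_support L <= N)%N.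
Proof.
rewrite /sup_support support_cons big_cat/= geq_max => /andP[/bigmax_leqP_seq h ->].
by split => //; apply/allP => x xc; exact: h.
Qed.

Lemma embeds_cyl c N : uniq (cyl_support c) ->
  all (fun x => x < N)%N (cyl_support c) -> embeds c.2 (item_size c.1) N.
Proof.
move=> u /allP h; split; last exact: uniq_mkseqP.
by move=> i il; apply: h; apply/mapP; exists i; rewrite ?mem_iota.
Qed.

Lemma shift_support h L : support (map (shift h) L) = map h (support L).
Proof.
elim: L => //= c L IH; rewrite !support_cons map_cat IH; congr (_ ++ _).
by rewrite /cyl_support /mkseq -map_comp.
Qed.

Lemma cyl_val01 N c (x : X N) : 0 <= cyl_val c x <= 1.
Proof. by rewrite /cyl_val indicE ler0n lern1 leq_b1. Qed.

Lemma cyls_val01 N L (x : X N) : 0 <= cyls_val L x <= 1.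
Proof. by apply: prodr_in01 => c; exact: cyl_val01. Qed.

Lemma measurable_cyls_val N L : inj_cyls L -> (sup_support L <= N)%N ->
  measurable_fun setT (@cyls_val N L).
Proof.
elim: L => [_ _|c L IH /= /andP[uc uL] /sup_support_cons[cN LN]].
  by rewrite /cyls_val; under eq_fun do rewrite big_nil; exact: measurable_cst.
rewrite /cyls_val; under eq_fun do rewrite big_cons.
apply: measurable_funM; last exact: IH.
apply: measurableT_comp; first exact/measurable_indic/item_measurable.
exact/nat_map_measurable/embeds_cyl.
Qed.

Lemma bmf_cyls_val N L : inj_cyls L -> (sup_support L <= N)%N -> bmf (@cyls_val N L).
Proof. by move=> pL LN; apply: bmf01 (cyls_val01 L); exact: measurable_cyls_val. Qed.

Lemma cyls_val_shift h L N K (x : X K) : inj_cyls L -> (sup_support L <= N)%N ->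
  embeds h N K -> cyls_val (map (shift h) L) x = cyls_val L (nat_map X h N K x).
Proof.
move=> pL LN hNK; elim: L pL LN => [_ _|c L IH /= /andP[uc uL] /sup_support_cons[cN LN]].
  by rewrite /cyls_val !big_nil.
rewrite /cyls_val !big_cons; congr (_ * _); last exact: IH.
by rewrite /cyl_val /= nat_map_comp//; exact: embeds_cyl.
Qed.

Lemma eq_cyls_val h L L' N (x : X N) : map fst L = map fst L' ->
  map h (support L) = support L' -> cyls_val (map (shift h) L) x = cyls_val L' x.
Proof.
elim: L L' => [|c L IH] [|c' L']//= [e eL].
rewrite !support_cons map_cat => /eqP; rewrite eqseq_cat; last first.
  by rewrite size_map !size_mkseq e.
move=> /andP[/eqP ec /eqP eL']; rewrite /cyls_val !big_cons; congr (_ * _); last exact: IH.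
rewrite /cyl_val /=; case: c c' e ec => [t phi] [t' phi'] /= <-.
rewrite /cyl_support/= => ec; congr (\1__ _); apply: nat_map_ext => i il.
have := congr1 (fun s => nth 0%N s i) ec.
by rewrite (nth_map 0%N) ?size_mkseq// !nth_mkseq.
Qed.

Variable p : nat_exch X.

Lemma Ex_nat_map phi n N (F : X n -> R) : embeds phi n N -> bmf F ->
  Ex (p N) (F \o nat_map X phi n N) = Ex (p n) F.
Proof.
move=> e bF; rewrite -(Ex_image_law (p N) (nat_map_measurable e))//.
by apply: eq_Ex_measure => A mA; rewrite image_lawE nat_law_map.
Qed.

(** The sample size chosen is the least one containing all positions read; by [cyls_probE] every
    larger size gives the same value. *)
Definition cyls_prob L : R := Ex (p (sup_support L)) (@cyls_val (sup_support L) L).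

Lemma shift_id L : map (shift id) L = L.
Proof. by rewrite -[RHS]map_id; apply: eq_map => -[]. Qed.

Lemma cyls_probE L N : inj_cyls L -> (sup_support L <= N)%N ->
  Ex (p N) (@cyls_val N L) = cyls_prob L.
Proof.
move=> pL LN; rewrite /cyls_prob -(Ex_nat_map (embeds_id LN)); last exact: bmf_cyls_val.
apply: eq_Ex => x /=; rewrite -[in LHS](shift_id L) (@cyls_val_shift _ _ (sup_support L))//.
exact: embeds_id.
Qed.

Lemma inj_cyls_shift h L : injective h -> inj_cyls L -> inj_cyls (map (shift h) L).
Proof.
move=> hI; elim: L => //= c L IH /andP[uc uL]; rewrite IH// andbT.
by rewrite /cyl_support/= /mkseq (map_comp h) map_inj_uniq.
Qed.

Lemma cyls_prob_shift h L : injective h -> inj_cyls L ->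
  cyls_prob (map (shift h) L) = cyls_prob L.
Proof.
move=> hI pL; pose N := sup_support L.
pose K := maxn (sup_support (map (shift h) L)) (\max_(i < N) (h i).+1).
have hNK : embeds h N K.
  split=> [i iN|i j _ _ /hI//]; rewrite /K leq_max; apply/orP; right.
  exact: (leq_bigmax (F := fun i : 'I_N => (h i).+1) (Ordinal iN)).
rewrite -(@cyls_probE _ K) ?leq_maxl//; last exact: inj_cyls_shift.
rewrite /cyls_prob -(Ex_nat_map hNK); last exact: bmf_cyls_val.
by apply: eq_Ex => x; exact: cyls_val_shift.
Qed.

(* Uniqueness of the support means that the maps are injective and have disjoint
   images. *)
Lemma cyls_prob_uniq L L' : map fst L = map fst L' ->
  uniq (support L) -> uniq (support L') -> cyls_prob L = cyls_prob L'.
Proof.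
(* Equal items have equal sizes, so the two supports have the same length. Matching them entry by
   entry is injective, and an injective extension to all integers shifts [L] to [L']. *)
move=> e u u'; pose h0 x := nth 0%N (support L') (index x (support L)).
have sz : size (support L) = size (support L').
  have aux (K : seq cylinder) : size (support K) = sumn (map item_size (map fst K)).
    by elim: K => //= c K IH; rewrite support_cons size_cat size_mkseq IH.
  by rewrite !aux e.
have h0E : map h0 (support L) = support L'.
  apply: (@eq_from_nth _ 0%N); rewrite size_map ?sz// => i il.
  by rewrite (nth_map 0%N) ?sz// /h0 index_uniq ?sz.
have h0I : {in support L &, injective h0}.
  move=> x y xL yL; rewrite /h0 => /eqP; rewrite nth_uniq// -?sz ?index_mem//.
  by move=> /eqP exy; rewrite -(nth_index 0%N xL) exy nth_index.
have [h hI hE] := extend_injection h0I.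
have hL : map h (support L) = support L'.
  by rewrite -h0E; apply/eq_in_map => x; exact: hE.
rewrite -(cyls_prob_shift hI); last exact: uniq_support_inj.
rewrite -(@cyls_probE _ (sup_support L')).
- by apply: eq_Ex => x; exact: eq_cyls_val.
- exact/(inj_cyls_shift hI)/uniq_support_inj.
- by rewrite /sup_support shift_support hL.
Qed.

(** The pairing function cuts the positions into infinitely many disjoint infinite columns, each of
    which has room for a sample of any size. *)
Definition column (c i : nat) : nat := choice.pickle (c, i).

Definition columns (cs : seq nat) l : seq cylinder := zip l (map column cs).

Lemma column_inj (c c' i i' : nat) : column c i = column c' i' -> c = c' /\ i = i'.
Proof. by move=> /(pcan_inj choice.pickleK)[-> ->]. Qed.

Lemma mem_support_columns cs l x : x \in support (columns cs l) ->
  exists2 c, c \in cs & exists i, x = column c i.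
Proof.
elim: cs l => [|c cs IH] [|t l]//; rewrite support_cons mem_cat => /orP[|/IH[c' c'cs ex]].
  by case/mapP => i _ ->; exists c; rewrite ?mem_head//; exists i.
by exists c' => //; rewrite inE c'cs orbT.
Qed.

Lemma uniq_columns cs l : uniq cs -> uniq (support (columns cs l)).
Proof.
elim: cs l => [|c cs IH] [|t l]//= /andP[ccs ucs].
rewrite support_cons cat_uniq IH// andbT; apply/andP; split.
  by apply: injective_mkseq_uniq => i j _ _ /column_inj[].
apply/hasPn => x /mem_support_columns[c' c'cs [i ->]]; apply/negP => /mapP[j _].
by move=> /column_inj[e _]; rewrite -e c'cs in ccs.
Qed.

(** By [cyls_prob_columns], any disjoint positions could replace the columns 0, 1, ... . These
    numbers will be the joint moments of the directing measures. *)
Definition columns_prob l := cyls_prob (columns (iota 0 (size l)) l).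

Lemma map_fst_columns cs l : (size l <= size cs)%N -> map fst (columns cs l) = l.
Proof. by move=> h; rewrite -/(unzip1 _) unzip1_zip// size_map. Qed.

Lemma cyls_prob_columns L : uniq (support L) -> cyls_prob L = columns_prob (map fst L).
Proof.
move=> u; apply: cyls_prob_uniq => //; last exact/uniq_columns/iota_uniq.
by rewrite map_fst_columns// size_iota.
Qed.

Lemma cyls_prob1 t phi : uniq (cyl_support (t, phi)) ->
  (cyls_prob [:: (t, phi)])%:E = p (item_size t) (item_set t).
Proof.
move=> u; rewrite (@cyls_prob_uniq _ [:: (t, id)])//.
- rewrite -(@cyls_probE _ (item_size t)).
  + rewrite -Ex_indic; last exact: item_measurable.
    have eid : embeds id (item_size t) (item_size t) by exact: embeds_id.
    rewrite -[in RHS](Ex_nat_map eid); last exact/bmf_indic/item_measurable.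
    by congr EFin; apply: eq_Ex => x; rewrite /cyls_val big_seq1.
  + by rewrite /inj_cyls/= andbT /cyl_support/= map_inj_uniq ?iota_uniq.
  + rewrite /sup_support support_cons cats0; apply/bigmax_leqP_seq => x.
    by rewrite /cyl_support /mkseq/= map_id mem_iota.
- by rewrite support_cons cats0.
- by rewrite support_cons cats0 /cyl_support/= map_inj_uniq ?iota_uniq.
Qed.

End cylinders.

Arguments item_set {R X} i _ : rename.

(** * Sampling along columns *)

Section sampling.
Context (R : realType) (X : nat_bds R) (p : nat_exch X).
Notation Omega := (measurableTypeR R).

Lemma measurable_code_le n y : measurable [set x : X n | nat_code X n x <= y].
Proof.
rewrite -[X in measurable X]setTI (_ : [set x | _] = nat_code X n @^-1` `]-oo, y]).
  by apply: nat_code_measurable => //; exact: measurable_itv.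
by apply/seteqP; split=> x; rewrite /= in_itv.
Qed.

Lemma measurable_code_lt n y : measurable [set x : X n | nat_code X n x < y].
Proof.
rewrite -[X in measurable X]setTI (_ : [set x | _] = nat_code X n @^-1` `]-oo, y[).
  by apply: nat_code_measurable => //; exact: measurable_itv.
by apply/seteqP; split=> x; rewrite /= in_itv.
Qed.

Definition le_item n y : item X := Item (@measurable_code_le n y).
Definition lt_item n y : item X := Item (@measurable_code_lt n y).

(* (n, q, c): the sample of size n read in column c has code at most q. *)
Definition sample_index := (nat * rat * nat)%type.
Implicit Types (j : sample_index).

Definition sample_cyl j : cylinder X := (le_item j.1.1 (ratr j.1.2), column j.2).

Lemma sample_cyl_uniq j : uniq (cyl_support (sample_cyl j)).
Proof. by apply: injective_mkseq_uniq => i i' _ _ /column_inj[]. Qed.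

Lemma inj_cyls_sample L : inj_cyls (map sample_cyl L).
Proof. by elim: L => //= j L ->; rewrite sample_cyl_uniq. Qed.

Let decode_index i : option sample_index := choice.unpickle i.

(** The sample indices are treated in the order of their codes; a sample of size [K N] contains all
    positions read by the indices with code below [N]. *)
Let K N := \max_(i < N) (if decode_index i is Some j then sup_support [:: sample_cyl j] else 0).

(** The full set is the default for numbers that code no index and for i >= N, whose positions may
    exceed [K N]. *)
Let A N i : set (X (K N)) :=
  if (i < N)%N then
    if decode_index i is Some j
    then nat_map X (column j.2) j.1.1 (K N) @^-1` item_set (sample_cyl j).1
    else setT
  else setT.
Arguments A : clear implicits.

Let K_ge N i j : (i < N)%N -> decode_index i = Some j ->
  (sup_support [:: sample_cyl j] <= K N)%N.
Proof.
move=> iN ij; apply: leq_trans (leq_bigmax (F := fun i : 'I_N =>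
  if decode_index i is Some j then sup_support [:: sample_cyl j] else 0) (Ordinal iN)).
by rewrite /= ij.
Qed.

Let embeds_K N i j : (i < N)%N -> decode_index i = Some j ->
  embeds (column j.2) j.1.1 (K N).
Proof.
move=> iN ij; have [h _] := sup_support_cons (K_ge iN ij).
exact: (embeds_cyl (sample_cyl_uniq j) h).
Qed.

Let mA N i : measurable (A N i).
Proof.
rewrite /A; case: ifPn => // iN; case ij: (decode_index i) => [j|]//.
rewrite -[X in measurable X]setTI; apply: (nat_map_measurable (embeds_K iN ij)) => //.
exact: measurable_code_le.
Qed.

Let K_mono N : (K N <= K N.+1)%N.
Proof. by rewrite /K big_ord_recr/= leq_max leqnn. Qed.

Let A_map N i x : (i < N)%N -> A N.+1 i x = A N i (nat_map X id (K N) (K N.+1) x).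
Proof.
move=> iN; rewrite /A ltnW// iN; case ij: (decode_index i) => [j|]//=.
by rewrite nat_map_comp//; [exact: embeds_K ij|exact/embeds_id/K_mono].
Qed.

Let A_consistent N s : p (K N.+1) [set x | pattern (A N.+1) N x = s] =
  p (K N) [set x | pattern (A N) N x = s].
Proof.
rewrite -(nat_law_map _ (embeds_id (K_mono N))); last exact: measurable_pattern.
congr (p _ _); apply/seteqP; split=> x /= <-; apply/eq_in_map => i;
  by rewrite mem_iota add0n => /= iN; rewrite A_map.
Qed.

Lemma nth_pattern d (T : measurableType d) (B : nat -> set T) N x i : (i < N)%N ->
  nth false (pattern B N x) i = `[<B i x>].
Proof. by move=> iN; rewrite nth_mkseq. Qed.

(** The last three clauses hold at every point: each finite pattern of [E] is realised by a point of
    some [X (K N)], where they are properties of the code. As a result the limit frequencies will be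
    monotone in q everywhere. *)
Lemma exchangeable_sample : exists E : sample_index -> set Omega,
  [/\ forall j, measurable (E j),
      forall L, Ex (unif01 R) (fun w => \prod_(j <- L) \1_(E j) w) =
                cyls_prob p (map sample_cyl L),
      forall n q q' c, q <= q' -> E (n, q, c) `<=` E (n, q', c),
      forall n q c, 1 <= q -> E (n, q, c) = setT
    & forall n q c, q < 0 -> E (n, q, c) = set0].
Proof.
have [E [mE EA Epat]] :=
  @binary_process R _ (fun N => X (K N)) (fun N => p (K N)) A mA A_consistent.
have decodeK j : decode_index (choice.pickle j) = Some j by exact: choice.pickleK.
exists (fun j => E (choice.pickle j)).
(* The maximum makes the pattern long enough for [j] and for a second index, with code below [N],
   that is to be compared with it. *)
have real j (w : Omega) N : exists y : X (K (maxn N (choice.pickle j).+1)),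
    forall j', (choice.pickle j' < maxn N (choice.pickle j).+1)%N ->
    E (choice.pickle j') w <->
    (nat_code X j'.1.1 (nat_map X (column j'.2) j'.1.1 _ y) <= ratr j'.1.2).
  have [y yw] := Epat (maxn N (choice.pickle j).+1) w; exists y => j' j'N.
  have := congr1 (fun s => nth false s (choice.pickle j')) yw.
  rewrite !nth_pattern// /A j'N decodeK/= => e.
  by split=> [Ew|h]; apply/asboolP; [rewrite e; exact/asboolP|rewrite -e; exact/asboolP].
split=> [j|L|n q q' c qq' w|n q c q1|n q c q0].
- exact: mE.
- pose N := \max_(j <- L) (choice.pickle j).+1.
  have LN j : j \in L -> (choice.pickle j < N)%N.
    by move=> jL; exact: (leq_bigmax_seq (F := fun j => (choice.pickle j).+1)).
  pose f (s : seq bool) : R := \prod_(j <- L) (nth false s (choice.pickle j))%:R.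
  have e w : \prod_(j <- L) \1_(E (choice.pickle j)) w = f (pattern E N w).
    rewrite /f [LHS]big_seq [RHS]big_seq; apply: eq_bigr => j /LN jN.
    by rewrite nth_pattern.
  rewrite (eq_Ex _ e) EA -(@cyls_probE _ _ _ _ (K N)); [|exact: inj_cyls_sample|].
    apply: eq_Ex => x; rewrite /f /cyls_val big_map [LHS]big_seq [RHS]big_seq.
    apply: eq_bigr => j /LN jN.
    by rewrite nth_pattern// /A jN decodeK.
  apply/bigmax_leqP_seq => x + _.
  rewrite /support -map_comp => /flatten_mapP[j jL xj].
  have /sup_support_cons[/allP h _] := K_ge (LN _ jL) (decodeK j).
  exact: h.
- have [y yE] := real (n, q, c) w (choice.pickle (n, q', c)).+1.
  move=> /yE; rewrite leq_max leqnn orbT => /(_ isT) h.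
  apply/yE; first by rewrite leq_max leqnn.
  by apply: (le_trans h); rewrite ler_rat.
- apply/seteqP; split=> // w _; have [y yE] := real (n, q, c) w 0%N.
  apply/yE; first by rewrite leq_max leqnn orbT.
  rewrite /=; apply: (@le_trans _ _ 1).
    by case/andP: (nat_code01 (nat_map X (column c) n _ y)).
  by rewrite -(rmorph1 (@ratr R)) ler_rat.
- rewrite -subset0 => w; have [y yE] := real (n, q, c) w 0%N.
  move=> /yE; rewrite leq_max leqnn orbT => /(_ isT)/=.
  have /andP[h _] := nat_code01 (nat_map X (column c) n _ y).
  move=> /(le_trans h); rewrite -(rmorph0 (@ratr R)) ler_rat => /le_lt_trans.
  by move=> /(_ _ q0); rewrite ltxx.
Qed.

End sampling.

(** * Almost sure convergence of frequencies *)

Section real_limsup.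
Context (R : realType).
Implicit Types u v : nat -> R.

(** The upper limit exists for every bounded sequence and is monotone in it, so limit frequencies
    are defined, measurable and ordered in q at every point; almost everywhere they are limits. *)
Definition limsup01 u : R := fine (limn_esup (fun k => (u k)%:E)).

Lemma le_limn_esup (u v : nat -> \bar R) :
  (forall k, u k <= v k)%E -> (limn_esup u <= limn_esup v)%E.
Proof.
move=> uv; rewrite !limn_esup_lim; apply: lee_lim; [exact: is_cvg_esups..|].
apply: nearW => n; apply: ge_ereal_sup => _ [k nk <-].
by apply: (le_trans (uv k)); apply: ereal_sup_ubound; exists k.
Qed.

Lemma limn_esup_cst c : limn_esup (fun=> c%:E) = c%:E :> \bar R.
Proof.
rewrite (@is_cvg_limn_esupE _ (fun=> c%:E)) ?lim_cst//.
exact: cvg_cst.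
Qed.

Let bounds u : (forall k, 0 <= u k <= 1) ->
  (0 <= limn_esup (fun k => (u k)%:E) <= 1)%E.
Proof.
move=> u01; apply/andP; split.
  have := @le_limn_esup (fun=> 0%:E) (fun k => (u k)%:E); rewrite limn_esup_cst; apply.
  by move=> k; rewrite lee_fin; case/andP: (u01 k).
have := @le_limn_esup (fun k => (u k)%:E) (fun=> 1%:E); rewrite limn_esup_cst; apply.
by move=> k; rewrite lee_fin; case/andP: (u01 k).
Qed.

Lemma limsup01E u : (forall k, 0 <= u k <= 1) ->
  (limsup01 u)%:E = limn_esup (fun k => (u k)%:E).
Proof.
move=> /bounds/andP[h0 h1]; rewrite /limsup01 fineK//.
by rewrite ge0_fin_numE// (le_lt_trans h1)// ltry.
Qed.

Lemma limsup01_in u : (forall k, 0 <= u k <= 1) -> 0 <= limsup01 u <= 1.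
Proof. by move=> u01; rewrite -!lee_fin limsup01E//; exact: bounds. Qed.

Lemma le_limsup01 u v : (forall k, 0 <= u k <= 1) -> (forall k, 0 <= v k <= 1) ->
  (forall k, u k <= v k) -> limsup01 u <= limsup01 v.
Proof.
move=> u01 v01 uv; rewrite -lee_fin !limsup01E//.
by apply: le_limn_esup => k; rewrite lee_fin.
Qed.

Lemma limsup01_cvg u : cvgn u -> u @ \oo --> limsup01 u.
Proof.
move=> cu; have h : (EFin \o u) @ \oo --> (limn u)%:E.
  by apply/cvg_EFin => //; exact: nearW.
rewrite /limsup01 is_cvg_limn_esupE; last by apply/cvg_ex; exists (limn u)%:E.
by rewrite (cvg_lim _ h).
Qed.

Lemma measurable_limsup01 d (T : measurableType d) (F : nat -> T -> R) :
  (forall k, measurable_fun setT (F k)) ->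
  measurable_fun setT (fun x => limsup01 (F ^~ x)).
Proof.
move=> mF; apply: measurableT_comp => //.
by apply: measurable_fun_limn_esup => k; exact/measurable_EFinP.
Qed.

End real_limsup.

Section almost_sure_convergence.
Context d (T : measurableType d) (R : realType) (P : probability T R).

(** The sum of the |F k.+1 - F k| has finite expectation, so it is finite almost everywhere; there
    the telescoping series converges absolutely. *)
Lemma ae_cvg_fast (F : nat -> T -> R) (C : R) : (forall k, bmf (F k)) ->
  (forall k, Ex P (fun x => `|F k.+1 x - F k x|) <= C / 2 ^+ k) ->
  {ae P, forall x, cvgn (F ^~ x)}.
Proof.
move=> bF FC; pose D k x : R := `|F k.+1 x - F k x|.
have bD k : bmf (D k) by apply: bmf_norm; exact: bmfB.
have D0 k x : (0 <= (D k x)%:E)%E by rewrite lee_fin /D.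
have mD k : measurable_fun setT (fun x => (D k x)%:E).
  by apply/measurable_EFinP; case: (bD k).
pose g x := (\sum_(k <oo) (D k x)%:E)%E.
have g0 x : (0 <= g x)%E by exact: nneseries_ge0.
have mg : measurable_fun setT g.
  by apply: ge0_emeasurable_sum => // k x _ _; exact: D0.
have C0 : 0 <= C.
  by have := FC 0%N; rewrite expr0 divr1; apply: le_trans; exact: Ex_ge0.
have int_g : (\int[P]_x g x <= (2 * C)%:E)%E.
  rewrite integral_nneseries//; apply: lime_le.
    by apply: is_cvg_nneseries => k _ _; exact: integral_ge0.
  apply: nearW => n.
  rewrite (eq_bigr (fun k => (Ex P (D k))%:E)); last by move=> k _; rewrite ExE.
  rewrite sumEFin lee_fin big_mkord.
  (* The right-hand side is the exact partial sum of the geometric series C / 2^k, which is what the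
     induction can carry. *)
  suff : \sum_(k < n) Ex P (D k) <= 2 * C - 2 * C / 2 ^+ n.
    by move/le_trans; apply; rewrite lerBlDr lerDl divr_ge0 ?exprn_ge0 ?mulr_ge0.
  elim: n => [|n IH]; first by rewrite big_ord0 expr0 divr1 subrr.
  rewrite big_ord_recr/=; apply: (le_trans (lerD IH (FC n))).
  rewrite exprS le_eqVlt; apply/orP; left; apply/eqP.
  by field; rewrite expf_neq0.
have ig : P.-integrable setT g.
  apply/integrableP; split => //; under eq_integral do rewrite gee0_abs//.
  by apply: (le_lt_trans int_g); rewrite ltry.
have := integrable_ae measurableT ig; apply: filterS => x /(_ I) gx.
have gE : (fine (g x))%:E = g x by rewrite fineK.
have cs : cvgn [normed series (fun k => F k.+1 x - F k x)].
  apply: nondecreasing_is_cvgn.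
    by apply: nondecreasing_series => n _ _; exact: normr_ge0.
  exists (fine (g x)) => _ [n _ <-]; rewrite -lee_fin gE /series/= -sumEFin.
  by apply: nneseries_lim_ge => k _ _; exact: D0.
have -> : F ^~ x = (fun n => F 0%N x + series (telescope (F ^~ x)) n).
  by apply/funext => n; rewrite -eq_sum_telescope.
apply: is_cvgD; first exact: is_cvg_cst.
exact: (normed_cvg cs).
Qed.

Lemma ae_cvg_fast2 (F : nat -> T -> R) : (forall k, bmf (F k)) ->
  (forall k, Ex P (fun x => (F k.+1 x - F k x) ^+ 2) <= 2 / 4 ^+ k) ->
  {ae P, forall x, cvgn (F ^~ x)}.
Proof.
move=> bF FC; apply: (@ae_cvg_fast F 2) => // k.
have bd : bmf (fun x => F k.+1 x - F k x) by exact: bmfB.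
have bd2 : bmf (fun x => (F k.+1 x - F k x) ^+ 2).
  by under eq_fun do rewrite expr2; exact: bmfM.
pose a : R := 2 ^+ k; have a0 : 0 < a by rewrite exprn_gt0.
have a4 : 4 ^+ k = a ^+ 2 by rewrite /a -exprM mulnC exprM; congr (_ ^+ _); ring.
(* AM-GM: |d| <= (2^k d^2 + 2^-k) / 2. *)
have h : Ex P (fun x => `|F k.+1 x - F k x|) <=
    Ex P (fun x => 2^-1 * a * (F k.+1 x - F k x) ^+ 2 + 2^-1 / a).
  apply: le_Ex; first exact: bmf_norm.
    by apply: bmfD; [apply: bmfM => //|]; exact: bmf_cst.
  move=> x; rewrite -real_normK ?num_real//; set y := `|_|.
  have -> : 2^-1 * a * y ^+ 2 + 2^-1 / a = y + (a * y - 1) ^+ 2 / (2 * a).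
    by field; rewrite gt_eqF.
  by rewrite lerDl divr_ge0 ?sqr_ge0// mulr_ge0// ltW.
apply: (le_trans h); rewrite ExD; [rewrite ExZ// Ex_cst| |exact: bmf_cst]; last first.
  by apply: bmfM => //; exact: bmf_cst.
have := FC k; rewrite a4 -/a => fc.
apply: (@le_trans _ _ (2^-1 * a * (2 / a ^+ 2) + 2^-1 / a)).
  by rewrite lerD2r ler_wpM2l// mulr_ge0// ltW.
(* The outcome (3/2) / 2^k lies below the bound 2 / 2^k announced at the start. *)
have -> : 2^-1 * a * (2 / a ^+ 2) + 2^-1 / a = 3 / 2 / a by field; rewrite gt_eqF.
by rewrite ler_pM2r ?invr_gt0//; lra.
Qed.

End almost_sure_convergence.

Lemma cvg_prod_seq (R : realType) I (r : seq I) (F : I -> nat -> R) (l : I -> R) :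
  (forall i, F i @ \oo --> l i) ->
  (fun n => \prod_(i <- r) F i n) @ \oo --> \prod_(i <- r) l i.
Proof.
move=> Fl; elim: r => [|i r IH].
  by rewrite big_nil; under eq_fun do rewrite big_nil; exact: cvg_cst.
by rewrite big_cons; under eq_fun do rewrite big_cons; exact: cvgM.
Qed.

Section limit_frequencies.
Context (R : realType) (X : nat_bds R) (p : nat_exch X).
Notation Omega := (measurableTypeR R).
Notation P := (unif01 R).
Variable E : sample_index -> set Omega.
Hypothesis mE : forall j, measurable (E j).
Hypothesis E_joint : forall L, Ex P (fun w => \prod_(j <- L) \1_(E j) w) =
  cyls_prob p (map (@sample_cyl R X) L).

Implicit Types (a : nat * rat) (L : seq (nat * rat * nat)).

Definition code_item a : item X := le_item X a.1 (ratr a.2).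

(* The k-th frequency uses the 4^k columns numbered by the pairs (k, j), so that
   frequencies of different ranks depend on disjoint samples. *)
Definition frequency k a (w : Omega) : R :=
  (4 ^+ k)^-1 * \sum_(j < 4 ^ k) \1_(E (a, column k j)) w.

Let bmf_prodE L : bmf (fun w => \prod_(j <- L) \1_(E j) w : R).
Proof. by apply: bmf_prod => j; apply: bmf_indic. Qed.

Lemma bmf_frequency k a : bmf (frequency k a).
Proof.
apply: bmfM; first exact: bmf_cst.
by apply: bmf_sum => j; apply: bmf_indic.
Qed.

Lemma frequency01 k a w : 0 <= frequency k a w <= 1.
Proof.
rewrite /frequency mulr_ge0 ?invr_ge0 ?exprn_ge0 ?sumr_ge0//=.
rewrite ler_pdivrMl ?exprn_gt0// mulr1.
apply: (@le_trans _ _ (\sum_(j < 4 ^ k) 1)); last first.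
  by rewrite sumr_const card_ord natrX.
by apply: ler_sum => j _; rewrite indicE lern1 leq_b1.
Qed.

Lemma support_sample_cyl L :
  map (@sample_cyl R X) L = columns (map snd L) (map code_item (map fst L)).
Proof. by elim: L => //= -[a c] L ->. Qed.

Lemma Ex_indic_columns L : uniq (map snd L) ->
  Ex P (fun w => \prod_(j <- L) \1_(E j) w) =
  columns_prob p (map code_item (map fst L)).
Proof.
move=> u; rewrite E_joint support_sample_cyl cyls_prob_columns ?map_fst_columns//.
  by rewrite !size_map.
exact: uniq_columns.
Qed.

(** Each factor is an average over columns, and different ranks use different columns. On expanding
    the product, every term is a joint event in distinct columns and has the same expectation; [L]
    collects the columns already chosen. Here [column k j] is the number of a column, not a
    position. *)
Lemma Ex_frequency_columns (l : seq (nat * (nat * rat))) L : uniq (map fst l) ->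
  uniq (map snd L) ->
  (forall k j, k \in map fst l -> column k j \notin map snd L) ->
  Ex P (fun w => (\prod_(ka <- l) frequency ka.1 ka.2 w) * \prod_(j <- L) \1_(E j) w) =
  columns_prob p (map code_item (map fst L ++ map snd l)).
Proof.
elim: l L => [|[k a] l IH] L /= u uL h.
  under eq_Ex do rewrite big_nil mul1r.
  by rewrite Ex_indic_columns// cats0.
move: u => /andP[kl ul].
have bl : bmf (fun w => \prod_(ka <- l) frequency ka.1 ka.2 w).
  by apply: bmf_prod => ka; exact: bmf_frequency.
have e w : (\prod_(ka <- (k, a) :: l) frequency ka.1 ka.2 w) * \prod_(j <- L) \1_(E j) w =
    (4 ^+ k)^-1 * \sum_(i < 4 ^ k) ((\prod_(ka <- l) frequency ka.1 ka.2 w) *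
      \prod_(j <- rcons L (a, column k i)) \1_(E j) w).
  rewrite big_cons /= /frequency -!mulrA; congr (_ * _).
  rewrite [LHS]mulrC mulr_sumr; apply: eq_bigr => i _.
  by rewrite big_rcons/= mulrA.
rewrite (eq_Ex _ e) ExZ; last by apply: bmf_sum => i; exact: bmfM.
rewrite Ex_sum; last by move=> i; exact: bmfM.
rewrite (eq_bigr (fun=> columns_prob p (map code_item (map fst L ++ a :: map snd l)))).
  rewrite sumr_const card_ord -[_ *+ (4 ^ k)]mulr_natl natrX mulrA mulVf ?mul1r//.
move=> i _; rewrite IH//.
- by rewrite map_rcons cat_rcons.
- by rewrite map_rcons rcons_uniq uL h// mem_head.
- move=> k' j k'l; rewrite map_rcons mem_rcons inE negb_or h ?inE ?k'l ?orbT// andbT.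
  by apply/eqP => /column_inj[ek _]; move: kl; rewrite -ek k'l.
Qed.

Lemma Ex_frequencies (l : seq (nat * (nat * rat))) : uniq (map fst l) ->
  Ex P (fun w => \prod_(ka <- l) frequency ka.1 ka.2 w) =
  columns_prob p (map code_item (map snd l)).
Proof.
move=> u; rewrite -(@Ex_frequency_columns l [::])//.
by apply: eq_Ex => w; rewrite big_nil mulr1.
Qed.

Let v a := columns_prob p [:: code_item a; code_item a].

(** Of the 16^k pairs of columns, those off the diagonal contribute [v a] each and the 4^k diagonal
    ones at most 1 each, hence an excess of at most 4^-k after division. *)
Lemma Ex_frequency_sq k a : Ex P (fun w => frequency k a w * frequency k a w) <=
  v a + (4 ^+ k)^-1.
Proof.
pose m : R := 4 ^+ k; have m0 : 0 < m by rewrite exprn_gt0.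
have mk : m = (4 ^ k)%:R by rewrite /m natrX.
pose G i j (w : Omega) : R := \prod_(l <- [:: (a, column k i); (a, column k j)]) \1_(E l) w.
have e w : frequency k a w * frequency k a w =
    m^-1 * (m^-1 * \sum_(i < 4 ^ k) \sum_(j < 4 ^ k) G i j w).
  rewrite /frequency -/m mulrACA -mulrA; do 2!congr (_ * _).
  rewrite mulr_suml; apply: eq_bigr => i _; rewrite mulr_sumr; apply: eq_bigr => j _.
  by rewrite /G big_cons big_seq1.
have bG i j : bmf (G i j) by exact: bmf_prodE.
have bS i : bmf (fun w => \sum_(j < 4 ^ k) G i j w) by exact: bmf_sum.
rewrite (eq_Ex _ e) ExZ ?ExZ ?Ex_sum//; last 2 first.
- by apply: bmf_sum.
- by apply: bmfM; [exact: bmf_cst|exact: bmf_sum].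
have le (i : 'I_(4 ^ k)) : Ex P (fun w => \sum_(j < 4 ^ k) G i j w) <= m * v a + 1.
  rewrite Ex_sum//.
  apply: (@le_trans _ _ (\sum_(j < 4 ^ k) (v a + (j == i)%:R))); last first.
    rewrite big_split/= sumr_const card_ord -[_ *+ (4 ^ k)]mulr_natl -mk lerD2l.
    by rewrite -natr_sum -big_mkcond/= sum1_card card1.
  apply: ler_sum => j _; have [->|ji] := eqVneq j i.
    apply: (@le_trans _ _ 1); last first.
      by rewrite lerDr; apply: Ex_ge0 => x; apply: prodr_ge0 => c _;
        by case/andP: (cyl_val01 c x).
    rewrite -(Ex_cst P 1); apply: le_Ex => //; first exact: bmf_cst.
    move=> w; suff /andP[//] : 0 <= G i i w <= 1.
    by apply: prodr_in01 => l; rewrite indicE ler0n lern1 leq_b1.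
  rewrite addr0 Ex_indic_columns//= inE andbT; apply/eqP => /column_inj[_ ij].
  by move/eqP: ji; apply; exact: val_inj.
rewrite -(ler_pM2l m0) !mulrA mulfV ?gt_eqF// mul1r ler_pdivrMl//.
apply: (le_trans (ler_sum _ (fun i _ => le i))).
rewrite sumr_const card_ord -[_ *+ (4 ^ k)]mulr_natl -mk ler_pM2l// mulrDr /v.
by rewrite divff ?gt_eqF.
Qed.

(** The cross term has expectation exactly [v a], since the two ranks use distinct columns. Thus
    [v a] cancels, and what remains is at most the two diagonal excesses. Averaging over 4^k columns
    makes this decay fast enough for almost sure convergence of the whole sequence. *)
Lemma Ex_frequency_dist k a :
  Ex P (fun w => (frequency k.+1 a w - frequency k a w) ^+ 2) <= 2 / 4 ^+ k.
Proof.
have e w : (frequency k.+1 a w - frequency k a w) ^+ 2 =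
   (frequency k.+1 a w * frequency k.+1 a w + frequency k a w * frequency k a w)
   - 2 * (\prod_(ka <- [:: (k.+1, a); (k, a)]) frequency ka.1 ka.2 w).
  by rewrite big_cons big_seq1/=; ring.
have bf i := bmf_frequency i a.
have bff i j : bmf (fun w => frequency i a w * frequency j a w) by exact: bmfM.
have bp : bmf (fun w => \prod_(ka <- [:: (k.+1, a); (k, a)]) frequency ka.1 ka.2 w).
  by apply: bmf_prod => ka; exact: bmf_frequency.
rewrite (eq_Ex _ e) ExB; [|exact: bmfD|by apply: bmfM => //; exact: bmf_cst].
rewrite ExD// ExZ// Ex_frequencies/=; last by rewrite inE andbT gtn_eqF.
have h1 := Ex_frequency_sq k.+1 a; have h0 := Ex_frequency_sq k a.
rewrite -/(v a).
have : (4 ^+ k.+1)^-1 <= (4 ^+ k)^-1 :> R.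
  by rewrite lef_pV2 ?posrE ?exprn_gt0// ler_eXn2l// ltr1n.
lra.
Qed.

Definition limit_frequency a (w : Omega) : R := limsup01 (fun k => frequency k a w).

Lemma limit_frequency01 a w : 0 <= limit_frequency a w <= 1.
Proof. by apply: limsup01_in => k; exact: frequency01. Qed.

Lemma measurable_limit_frequency a : measurable_fun setT (limit_frequency a).
Proof. by apply: measurable_limsup01 => k; case: (bmf_frequency k a). Qed.

Lemma bmf_limit_frequency a : bmf (limit_frequency a).
Proof. by apply: bmf01; [exact: measurable_limit_frequency|exact: limit_frequency01]. Qed.

Lemma frequency_cvg a :
  {ae P, forall w, (fun k => frequency k a w) @ \oo --> limit_frequency a w}.
Proof.
have := ae_cvg_fast2 (fun k => bmf_frequency k a) (fun k => Ex_frequency_dist k a).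
by apply: filterS => w; exact: limsup01_cvg.
Qed.

Lemma Ex_limit_frequencies (l : seq (nat * rat)) :
  Ex P (fun w => \prod_(a <- l) limit_frequency a w) = columns_prob p (map code_item l).
Proof.
(* The ranks k, k + 1, ... are distinct even if [l] has repetitions, so the expectation is the same
   for every [k], while shifting the rank of a factor does not affect its limit. *)
pose F k w := \prod_(i < size l) frequency (k + i) (nth (0%N, 0) l i) w.
have FE k : Ex P (F k) = columns_prob p (map code_item l).
  pose ks := [seq (k + i)%N | i <- iota 0 (size l)].
  have zE : map snd (zip ks l) = l.
    by rewrite -/(unzip2 _) unzip2_zip// size_map size_iota.
  rewrite -[in RHS]zE -Ex_frequencies; last first.
    rewrite -/(unzip1 _) unzip1_zip ?size_map ?size_iota//.
    by rewrite map_inj_uniq ?iota_uniq//; exact: addnI.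
  apply: eq_Ex => w; rewrite (big_nth (0%N, (0%N, 0)))/= size_zip size_map size_iota minnn.
  rewrite big_mkord; apply: eq_bigr => i _.
  by rewrite nth_zip ?size_map ?size_iota//= (nth_map 0%N) ?size_iota// nth_iota.
have bF k : bmf (F k) by apply: bmf_prod => i; exact: bmf_frequency.
have eT w : \prod_(a <- l) limit_frequency a w =
    \prod_(i < size l) limit_frequency (nth (0%N, 0) l i) w.
  by rewrite (big_nth (0%N, 0)) big_mkord.
have cv : Ex P (F k) @[k --> \oo] --> Ex P (fun w => \prod_(a <- l) limit_frequency a w).
  apply: (@Ex_cvg _ _ _ _ _ _ 1).
  - by move=> k; case: (bF k).
  - move=> k w; have /andP[F0 F1] : 0 <= F k w <= 1.
      by apply: prodr_in01 => i; exact: frequency01.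
    by rewrite ger0_norm.
  - by apply: bmf_prod => a; exact: bmf_limit_frequency.
  - have := ae_foralln (fun i => frequency_cvg (nth (0%N, 0) l i)).
    apply: filterS => w h; rewrite eT.
    apply: (@cvg_prod_seq R _ _ (fun (i : 'I_(size l)) k =>
       frequency (k + i) (nth (0%N, 0) l i) w)) => i.
    by have := h i; rewrite -(cvg_shiftn i).
rewrite -(cvg_lim _ cv)//; under eq_fun do rewrite FE.
by rewrite lim_cst.
Qed.

End limit_frequencies.

Section directing_frequencies.
Context (R : realType) (X : nat_bds R) (p : nat_exch X).

Lemma directing_frequencies : exists F : nat * rat -> measurableTypeR R -> R,
  [/\ forall a, measurable_fun setT (F a), forall a w, 0 <= F a w <= 1,
      forall n q q' w, q <= q' -> F (n, q) w <= F (n, q') w,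
      forall n q w, (1 <= q -> F (n, q) w = 1) /\ (q < 0 -> F (n, q) w = 0)
    & forall l, Ex (unif01 R) (fun w => \prod_(a <- l) F a w) =
        columns_prob p (map (@code_item R X) l)].
Proof.
have [E [mE EE Emono E1 E0]] := exchangeable_sample p.
exists (limit_frequency E); split => [a|a w|n q q' w qq'|n q w|l].
- exact: measurable_limit_frequency.
- exact: limit_frequency01.
- apply: le_limsup01 => k; [exact: frequency01..|].
  rewrite ler_pM2l ?invr_gt0 ?exprn_gt0//; apply: ler_sum => j _.
  rewrite !indicE ler_nat; case: (boolP (w \in E (n, q, _))) => //.
  by rewrite inE => /(Emono _ _ _ _ qq') ?; rewrite mem_set.
- have c k : \sum_(j < 4 ^ k) 1 = 4 ^+ k :> R by rewrite sumr_const card_ord natrX.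
  split=> [q1|q0]; rewrite /limit_frequency.
    rewrite (_ : (fun k => _) = cst 1).
      by rewrite /limsup01 limn_esup_cst.
    apply/funext => k; rewrite /frequency.
    rewrite (eq_bigr (fun=> 1)) ?c ?mulVf ?expf_neq0// => j _.
    by rewrite E1// indicT.
  rewrite (_ : (fun k => _) = cst 0).
    by rewrite /limsup01 limn_esup_cst.
  apply/funext => k; rewrite /frequency.
  by rewrite big1 ?mulr0// => j _; rewrite E0// indic0.
- exact: Ex_limit_frequencies.
Qed.

End directing_frequencies.

(** * Directing measures *)

Section kernels.
Context (R : realType).
Notation line := (measurableTypeR R).

Section mixed_measure.
Context d (T : measurableType d) (P : probability T R) (Z : T -> R).
Variable kap : T -> {measure set line -> \bar R}.
Hypothesis bZ : bmf Z.
Hypothesis kapT : forall w, kap w setT = 1%E.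
Hypothesis mkap : forall B, measurable B -> measurable_fun setT (fun w => kap w B).

Lemma kernel_le1 w B : measurable B -> (0 <= kap w B <= 1)%E.
Proof. by move=> mB; rewrite measure_ge0/= -(kapT w) le_measure// inE. Qed.

Lemma kernel_fin w B : measurable B -> kap w B \is a fin_num.
Proof.
by move=> /(kernel_le1 w)/andP[h0 h1]; rewrite ge0_fin_numE// (le_lt_trans h1)// ltry.
Qed.

Lemma fine_kernel01 w B : measurable B -> 0 <= fine (kap w B) <= 1.
Proof. by move=> mB; rewrite -!lee_fin fineK ?kernel_fin//; exact: kernel_le1. Qed.

Lemma bmf_kernel B : measurable B -> bmf (fun w => fine (kap w B)).
Proof.
move=> mB; apply: bmf01 => [|w]; last exact: fine_kernel01.
by apply: measurableT_comp => //; exact: mkap.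
Qed.

(** Since [Z] may change sign, this is a signed measure in [B], kept as a real function;
    [mixed_setC] and [mixed_bigcup] are the closure properties for Dynkin induction. *)
Definition mixed B : R := Ex P (fun w => Z w * fine (kap w B)).

Lemma mixed_setT : mixed setT = Ex P Z.
Proof. by apply: eq_Ex => w; rewrite kapT mulr1. Qed.

Lemma mixed_setC B : measurable B -> mixed (~` B) = Ex P Z - mixed B.
Proof.
move=> mB; rewrite /mixed -ExB//; last by apply: bmfM => //; exact: bmf_kernel.
apply: eq_Ex => w; rewrite -{2}(mulr1 (Z w)) -mulrBr; congr (_ * _).
apply: EFin_inj; rewrite EFinB !fineK ?kernel_fin//; last exact: measurableC.
by rewrite -(kapT w) -setTD measureD// ?setTI// ltey_eq kernel_fin.
Qed.

Lemma mixed_cvg (F : (set line)^nat) B : measurable B -> (forall n, measurable (F n)) ->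
  (forall w, (fun n => kap w (F n)) @ \oo --> kap w B) ->
  (fun n => mixed (F n)) @ \oo --> mixed B.
Proof.
move=> mB mF FB; have [mZ [M ZM]] := bZ.
apply: (@Ex_cvgT _ _ _ _ _ _ (M * 1)) => [n|n w|w].
- by apply: measurable_funM => //; case: (bmf_kernel (mF n)).
- rewrite normrM; apply: ler_pM => //.
  by have /andP[h0 h1] := fine_kernel01 w (mF n); rewrite ger0_norm.
- apply: cvgMr; apply: fine_cvg; rewrite fineK ?kernel_fin//; exact: FB.
Qed.

Lemma mixed_bigcup (F : (set line)^nat) : (forall n, measurable (F n)) ->
  trivIset setT F ->
  (fun n => \sum_(i < n) mixed (F i)) @ \oo --> mixed (\bigcup_i F i).
Proof.
move=> mF tF; pose G n := \big[setU/set0]_(i < n) F i.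
have mG n : measurable (G n) by exact: bigsetU_measurable.
have mU : measurable (\bigcup_i F i) by exact: bigcupT_measurable.
rewrite (_ : (fun n => _) = fun n => mixed (G n)); last first.
  apply/funext => n; rewrite /mixed -Ex_sum; last first.
    by move=> i; apply: bmfM => //; exact: bmf_kernel.
  apply: eq_Ex => w; rewrite -mulr_sumr; congr (_ * _); apply: EFin_inj.
  rewrite -sumEFin fineK ?kernel_fin//.
  rewrite /G measure_semi_additive_ord//.
    by apply: eq_bigr => i _; rewrite fineK ?kernel_fin.
  by move=> i j _ _ h; apply: val_inj; exact: tF h.
  exact: mG.
apply: mixed_cvg => // w; have -> : \bigcup_i F i = \bigcup_n G n.
  apply/seteqP; split=> x [i _ h].
    by exists i.+1 => //; rewrite /G -bigcup_mkord; exists i => /=.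
  by move: h; rewrite /G -bigcup_mkord => -[j _ h]; exists j.
apply: nondecreasing_cvg_mu => //; first exact: bigcupT_measurable.
by move=> m n mn; apply/subsetPset; exact: subset_bigsetU.
Qed.

End mixed_measure.

(** Open rays form a pi-system, and the total masses agree as limits along the rays up to n. The two
    sides may live on different probability spaces, so that a random kernel on the unit interval can
    be compared with Dirac masses on a finite sample. *)
Lemma mixed_eq d (T : measurableType d) d' (T' : measurableType d')
    (P : probability T R) (P' : probability T' R) (Z : T -> R) (Z' : T' -> R)
    (kap : T -> {measure set line -> \bar R}) (kap' : T' -> {measure set line -> \bar R}) :
  bmf Z -> bmf Z' ->
  (forall w, kap w setT = 1%E) -> (forall w, kap' w setT = 1%E) ->
  (forall B, measurable B -> measurable_fun setT (fun w => kap w B)) ->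
  (forall B, measurable B -> measurable_fun setT (fun w => kap' w B)) ->
  (forall x : R, mixed P Z kap `]-oo, x[ = mixed P' Z' kap' `]-oo, x[) ->
  forall B, measurable B -> mixed P Z kap B = mixed P' Z' kap' B.
Proof.
move=> bZ bZ' kT kT' mk mk' e.
have mr (x : R) : measurable (`]-oo, x[%classic : set line) by exact: measurable_itv.
have eT : mixed P Z kap setT = mixed P' Z' kap' setT.
  have rT : \bigcup_n `]-oo, (n%:R : R)[%classic = setT.
    apply/seteqP; split=> // x _; exists (Num.truncn `|x|).+1 => //=.
    by rewrite in_itv/= (le_lt_trans (ler_norm _))// truncnS_gt.
  have cv d1 (S : measurableType d1) (Q : probability S R) (Y : S -> R)
      (k : S -> {measure set line -> \bar R}) : bmf Y -> (forall w, k w setT = 1%E) ->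
      (forall B, measurable B -> measurable_fun setT (fun w => k w B)) ->
      (fun n => mixed Q Y k `]-oo, n%:R[) @ \oo --> mixed Q Y k setT.
    move=> bY kYT mkY; apply: mixed_cvg => // w.
    rewrite -[in X in _ --> X]rT; apply: nondecreasing_cvg_mu => //.
      by rewrite rT.
    move=> m n mn; apply/subsetPset => x /=; rewrite !in_itv/= => /lt_le_trans; apply.
    by rewrite ler_nat.
  have := cv _ _ P Z kap bZ kT mk; under eq_fun do rewrite e.
  by move=> /(cvg_unique (@norm_hausdorff _ _)); apply; exact: cv.
move=> B mB; apply: (@dynkin_induction _ line (@RGenInftyO.G R)
  (fun B => mixed P Z kap B = mixed P' Z' kap' B) (RGenInftyO.measurableE R)) => //.
- move=> _ _ [x ->] [y ->]; exists (Num.min x y).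
  by apply/seteqP; split=> z /=; rewrite !in_itv/= lt_min => /andP.
- by move=> _ [x ->].
- by move=> S mS PS; rewrite !mixed_setC// PS -(mixed_setT P Z kT) eT mixed_setT.
- move=> F mF tF PF; have := @mixed_bigcup _ _ P _ _ bZ kT mk F mF tF.
  rewrite (_ : (fun n => _) = fun n => \sum_(i < n) mixed P' Z' kap' (F i)).
    by move=> /(cvg_unique (@norm_hausdorff _ _)); apply; exact: mixed_bigcup.
  by apply/funext => n; apply: eq_bigr => i _; exact: PF.
- by move: mB; rewrite {1}RGenInftyO.measurableE.
Qed.

End kernels.

(** * Rational approximation from below *)

Section rationals_below.
Context (R : realType).
Implicit Type x : R.

Lemma ratr_below x : exists q : rat, ratr q < x.
Proof.
have x1 : x - 1 < x by rewrite ltrBlDr ltrDl.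
by have [q /andP[_ qx]] := rat_in_itvoo x1; exists q.
Qed.

(** A running maximum, over an enumeration of the rationals, of those below [x]. It makes {code < x}
    an increasing limit of events {code <= q}, the only ones whose frequencies are available. *)
Fixpoint rat_below x k : rat :=
  if k is k.+1 then
    if choice.unpickle k is Some q
    then if ratr q < x then Num.max (rat_below x k) q else rat_below x k
    else rat_below x k
  else projT1 (cid (ratr_below x)).

Lemma rat_belowS x k : rat_below x k.+1 =
  if choice.unpickle k is Some q
  then if ratr q < x then Num.max (rat_below x k) q else rat_below x k
  else rat_below x k.
Proof. by []. Qed.

Lemma rat_below_lt x k : ratr (rat_below x k) < x.
Proof.
elim: k => [|k IH]; first by rewrite /=; case: cid.
rewrite rat_belowS; case: choice.unpickle => [q|//]; case: ifPn => // qx.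
by case: (leP (rat_below x k) q).
Qed.

Lemma rat_below_mono x : {homo rat_below x : m n / (m <= n)%N >-> m <= n}.
Proof.
apply: homo_leq => [//|y z t|n]; first exact: le_trans.
rewrite rat_belowS; case: choice.unpickle => [q|//]; case: ifPn => // qx.
by rewrite le_max lexx.
Qed.

Lemma rat_below_cofinal x q : ratr q < x ->
  exists k, forall n, (k <= n)%N -> q <= rat_below x n.
Proof.
move=> qx; exists (choice.pickle q).+1 => n kn.
apply: le_trans (rat_below_mono x kn).
by rewrite rat_belowS choice.pickleK qx le_max lexx orbT.
Qed.

End rationals_below.

Section directing_kernel.
Context (R : realType) (X : nat_bds R) (p : nat_exch X).
Notation line := (measurableTypeR R).
Notation P := (unif01 R).
Variable F : nat * rat -> line -> R.
Hypothesis mF : forall a, measurable_fun setT (F a).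
Hypothesis F01 : forall a w, 0 <= F a w <= 1.
Hypothesis F_mono : forall n q q' w, q <= q' -> F (n, q) w <= F (n, q') w.
Hypothesis F_out : forall n q w,
  (1 <= q -> F (n, q) w = 1) /\ (q < 0 -> F (n, q) w = 0).
Hypothesis F_joint : forall l, Ex P (fun w => \prod_(a <- l) F a w) =
  columns_prob p (map (@code_item R X) l).

(** The first coordinate selects the frequencies, the second is the uniform level. The set is
    nonempty because it contains 1, where the frequency is 1, and bounded below because it contains
    no negative rational. *)
Definition quantile n (z : line * line) : line :=
  inf [set x | exists2 q : rat, x = ratr q & clip z.2 < F (n, q) z.1].

(** The strict inequality turns the infimum into the existence of a rational, hence the event into a
    countable union. This is why rays are open from here on: the mass of []-oo, x[] is the supremum
    of the frequencies at rationals below x, which may differ from the frequency at x. *)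
Lemma quantile_lt n z (x : R) :
  quantile n z < x <-> exists2 q : rat, ratr q < x & clip z.2 < F (n, q) z.1.
Proof.
have /andP[c0 c1] := clip01 z.2.
pose S := [set x | exists2 q : rat, x = ratr q & clip z.2 < F (n, q) z.1] : set R.
have S0 : S !=set0.
  by exists (ratr 1); exists 1; rewrite // (F_out n 1 z.1).1.
have lS : has_lbound S.
  exists 0 => _ [q -> h]; rewrite -(rmorph0 (@ratr R)) ler_rat leNgt.
  apply/negP => q0; move: h; rewrite (F_out n q z.1).2//.
  by move=> /(le_lt_trans c0); rewrite ltxx.
split=> [/(inf_lt S0)[_ [q -> h] qx]|[q qx h]]; first by exists q.
by apply: le_lt_trans qx; apply: ge_inf => //; exists q.
Qed.

Lemma measurable_quantile n : measurable_fun setT (quantile n).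
Proof.
move=> mT; apply: (measurability _ (RGenInftyO.measurableE R)) => //.
move=> _ [_ [x ->] <-]; rewrite setTI.
rewrite (_ : _ @^-1` _ = \bigcup_(q in [set q : rat | ratr q < x])
    [set z | clip z.2 < F (n, q) z.1]).
  rewrite bigcup_mkcond; apply: bigcupT_measurable_rat => q; case: ifP => // _.
  rewrite -[X in measurable X]setTI.
  apply: measurable_fun_ltr => //.
    exact: (measurableT_comp (@measurable_clip R) measurable_snd).
  exact: (measurableT_comp (mF _) measurable_fst).
apply/seteqP; split=> z /=; rewrite in_itv/=.
  by move=> /quantile_lt[q qx h]; exists q.
by move=> [q /= qx h]; apply/quantile_lt; exists q.
Qed.

Lemma measurable_quantile_at n (w : line) : measurable_fun setT (fun u => quantile n (w, u)).
Proof. exact/(measurableT_comp (measurable_quantile n))/pair1_measurable. Qed.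

Definition code_kernel n w : probability line R :=
  image_law P (measurable_quantile_at n w).

Lemma measurable_code_kernel n B : measurable B ->
  measurable_fun setT (fun w => code_kernel n w B).
Proof.
move=> mB; have mA : measurable (quantile n @^-1` B).
  by rewrite -[X in measurable X]setTI; exact: measurable_quantile.
have := measurable_fun_xsection P mA.
congr measurable_fun; apply/funext => w /=; congr (P _).
by apply/seteqP; split=> u; rewrite /xsection /= inE.
Qed.

Lemma unif01_clip_lt (t : R) : 0 <= t <= 1 -> unif01 R [set u | clip u < t] = t%:E.
Proof.
move=> /andP[t0 t1]; rewrite (@unif01_itv _ 0 t) ?subr0//.
apply/seteqP; split=> u /=; rewrite /clip !in_itv/=.
  by case: ifPn => [h [ut _]|/negP h [_]//]; rewrite ut andbT; have [] := andP h.
move=> /andP[u0 ut]; have -> : (0 <= u < 1) by rewrite u0 (lt_le_trans ut).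
by [].
Qed.

Lemma code_kernel_ray n w (x : R) :
  (fun k => F (n, rat_below x k) w) @ \oo --> fine (code_kernel n w `]-oo, x[%classic).
Proof.
pose A k : set line := [set u | clip u < F (n, rat_below x k) w].
have mA k : measurable (A k).
  rewrite -[X in measurable X]setTI; apply: measurable_fun_ltr => //.
  exact: measurable_clip.
have AU : (fun u => quantile n (w, u)) @^-1` `]-oo, x[ = \bigcup_k A k.
  apply/seteqP; split=> u /=; rewrite in_itv/=.
    move=> /quantile_lt[q /= /rat_below_cofinal[k qk] h]; exists k => //=.
    by apply: (lt_le_trans h); apply: F_mono; exact: qk.
  move=> [k _ h]; apply/quantile_lt; exists (rat_below x k) => //.
  exact: rat_below_lt.
have cv : P \o A @ \oo --> P (\bigcup_k A k).
  apply: nondecreasing_cvg_mu => //; first exact: bigcupT_measurable.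
  move=> i j ij; apply/subsetPset => u /= /lt_le_trans; apply; apply: F_mono.
  exact: rat_below_mono.
have e : (fun k => F (n, rat_below x k) w) = fine \o (P \o A).
  by apply/funext => k /=; rewrite unif01_clip_lt.
rewrite e /code_kernel image_lawE AU; apply: fine_cvg; rewrite fineK//.
by rewrite fin_num_measure//; exact: bigcupT_measurable.
Qed.

Implicit Types (l : seq (item X)) (r : seq (nat * R)).

Definition ray_item (a : nat * R) : item X := lt_item X a.1 a.2.

Lemma support_columns_eq cs l l' : map (@item_size R X) l = map (@item_size R X) l' ->
  support (columns cs l) = support (columns cs l').
Proof.
elim: cs l l' => [|c cs IH] [|t l] [|t' l']//= [e el].
by rewrite !support_cons (IH l l')// /cyl_support/= e.
Qed.

Lemma cyls_val_code_cvg cs r N (x : X N) :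
  (fun k => cyls_val (columns cs
     (map (@code_item R X) [seq (a.1, rat_below a.2 k) | a <- r])) x) @ \oo -->
  cyls_val (columns cs (map ray_item r)) x.
Proof.
elim: cs r => [|c cs IH] [|a r];
  try by rewrite /cyls_val; under eq_fun do rewrite big_nil; rewrite big_nil; exact: cvg_cst.
rewrite /cyls_val /columns/=; under eq_fun do rewrite big_cons; rewrite big_cons.
apply: cvgM; last exact: IH.
apply: cvg_near_cst; rewrite /cyl_val /=.
set y := nat_map _ _ _ _ _; have [yx|yx] := ltP (nat_code X a.1 y) a.2.
  have [q] := rat_in_itvoo yx; rewrite in_itv/= => /andP[yq qx].
  have [k0 qk] := rat_below_cofinal qx; exists k0 => // k /= kk0.
  apply/eqP; rewrite !indicE !mem_set//=.
  by apply: (le_trans (ltW yq)); rewrite ler_rat; exact: qk.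
apply: nearW => k; apply/eqP; rewrite !indicE !memNset//=.
  by apply/negP; rewrite -leNgt.
by apply/negP; rewrite -ltNge; apply: (lt_le_trans (rat_below_lt _ _)).
Qed.

(** Both sides are limits of one sequence, obtained by replacing each bound by [rat_below]: on the
    left the frequencies converge to the masses of the rays, on the right the events {code <= q}
    increase to {code < x}. *)
Lemma code_kernel_rays r :
  Ex P (fun w => \prod_(a <- r) fine (code_kernel a.1 w `]-oo, a.2[%classic)) =
  columns_prob p (map ray_item r).
Proof.
pose rk k := [seq (a.1, rat_below a.2 k) | a <- r].
have cvF : Ex P (fun w => \prod_(a <- rk k) F a w) @[k --> \oo] -->
    Ex P (fun w => \prod_(a <- r) fine (code_kernel a.1 w `]-oo, a.2[%classic)).
  apply: (@Ex_cvgT _ _ _ _ _ _ 1) => [k|k w|w].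
  - suff [] : bmf (fun w => \prod_(a <- rk k) F a w) by [].
    by apply: bmf_prod => a; exact: bmf01.
  - suff /andP[h0 h1] : 0 <= \prod_(a <- rk k) F a w <= 1 by rewrite ger0_norm.
    exact: prodr_in01.
  - under eq_fun do rewrite big_map.
    by apply: cvg_prod_seq => a; exact: code_kernel_ray.
have cvV : Ex P (fun w => \prod_(a <- rk k) F a w) @[k --> \oo] -->
    columns_prob p (map ray_item r).
  under eq_fun do rewrite F_joint.
  set cs := iota 0 (size r); set L := columns cs (map ray_item r).
  pose Lk k := columns cs (map (@code_item R X) (rk k)).
  have sk k : support (Lk k) = support L.
    by apply: support_columns_eq; rewrite -!map_comp.
  have uL l : inj_cyls (columns cs l) by exact/uniq_support_inj/uniq_columns/iota_uniq.
  have supk k : (sup_support (Lk k) <= sup_support L)%N by rewrite /sup_support sk.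
  have Ek k : columns_prob p (map (@code_item R X) (rk k)) =
      Ex (p (sup_support L)) (cyls_val (Lk k)).
    by rewrite [RHS](cyls_probE p (uL _) (supk k)) /columns_prob !size_map.
  under eq_fun do rewrite Ek.
  rewrite /columns_prob size_map -/cs -/L /cyls_prob.
  apply: (@Ex_cvgT _ _ _ _ _ _ 1) => [k|k x|x].
  - exact: (measurable_cyls_val (uL _) (supk k)).
  - by have /andP[h0 h1] := cyls_val01 (Lk k) x; rewrite ger0_norm.
  - exact: cyls_val_code_cvg.
by apply: (cvg_unique (@norm_hausdorff _ _) cvF cvV).
Qed.

Definition sample_kernel n w : probability (X n) R :=
  image_law (code_kernel n w) (@nat_decode_measurable R X n).

Lemma measurable_sample_kernel n M : measurable M ->
  measurable_fun setT (fun w => sample_kernel n w M).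
Proof.
move=> mM; apply: measurable_code_kernel.
by rewrite -[X in measurable X]setTI; exact: nat_decode_measurable.
Qed.

Lemma cat_columns cs cs' l l' : size cs = size l ->
  columns (cs ++ cs') (l ++ l') = columns cs l ++ columns cs' l'.
Proof. by move=> e; rewrite /columns map_cat zip_cat// size_map. Qed.

(** Rays are replaced by arbitrary events one at a time. With the other factors frozen in a weight,
    both sides are [mixed] measures of the last event of [l], and they agree on rays by the
    induction hypothesis. Taking the last event keeps it in the same column when it moves to the
    head of [r]. *)
Lemma sample_kernel_mixed l r :
  Ex P (fun w => (\prod_(t <- l) fine (sample_kernel (item_size t) w (item_set t))) *
    \prod_(a <- r) fine (code_kernel a.1 w `]-oo, a.2[%classic)) =
  columns_prob p (l ++ map ray_item r).
Proof.
elim/last_ind: l r => [|l t IH] r.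
  rewrite cat0s -code_kernel_rays; apply: eq_Ex => w.
  by rewrite big_nil mul1r.
case: t => n M mM.
pose Z w := (\prod_(t <- l) fine (sample_kernel (item_size t) w (item_set t))) *
    \prod_(a <- r) fine (code_kernel a.1 w `]-oo, a.2[%classic).
have bZ : bmf Z.
  apply: bmfM; apply: bmf_prod => i.
    apply: bmf01 => [|w]; first apply: measurableT_comp => //.
      apply: measurable_sample_kernel; exact: item_measurable.
    rewrite -!lee_fin fineK ?fin_num_measure//; last exact: item_measurable.
    by rewrite measure_ge0 probability_le1//; exact: item_measurable.
  apply: bmf01 => [|w]; first apply: measurableT_comp => //.
    exact: measurable_code_kernel.
  by rewrite -!lee_fin fineK ?fin_num_measure// measure_ge0 probability_le1.
pose m := size l; pose cs := iota m.+1 (size r).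
have lE t : columns_prob p (l ++ t :: map ray_item r) =
    cyls_prob p (columns (iota 0 m) l ++ (t, column m) :: columns cs (map ray_item r)).
  rewrite /columns_prob size_cat /= size_map iotaD /= add0n.
  by rewrite cat_columns// size_iota.
pose L1 := columns (iota 0 m) l; pose L2 := columns cs (map ray_item r).
(* A placeholder: supports depend only on sizes, so the resulting [N] serves every event of size [n]
   put in column [m]. *)
pose t0 : item X := Item (measurableT : measurable [set: X n]).
pose N := sup_support (L1 ++ (t0, column m) :: L2).
have uL t : item_size t = n -> uniq (support (L1 ++ (t, column m) :: L2)).
  move=> tn; rewrite -[_ :: L2]/(columns (m :: cs) (t :: map ray_item r)).
  rewrite -cat_columns ?size_iota//; apply: uniq_columns.
  by rewrite -[m :: cs]/(iota m (size r).+1) -[m in iota m]add0n -iotaD iota_uniq.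
have supL t : item_size t = n -> sup_support (L1 ++ (t, column m) :: L2) = N.
  move=> tn; rewrite /N /sup_support !support_cat !support_cons.
  by rewrite /cyl_support/= tn.
have emN : embeds (column m) n N.
  have h := supL t0 erefl; split; last by move=> i j _ _ /column_inj[].
  move=> i il; rewrite -h /sup_support support_cat support_cons !big_cat/=.
  rewrite !leq_max; apply/orP; right; apply/orP; left.
  apply: (@leq_bigmax_seq _ _ xpredT (fun x => x.+1) (column m i)) => //.
  by rewrite /cyl_support/=; apply/mapP; exists i; rewrite ?mem_iota.
pose Z' (x : X N) : R := cyls_val L1 x * cyls_val L2 x.
have catE t (x : X N) : cyls_val (L1 ++ (t, column m) :: L2) x =
    Z' x * cyl_val (t, column m) x.
  by rewrite /Z' /cyls_val big_cat big_cons /= mulrCA mulrC.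
have iL t : item_size t = n -> inj_cyls (L1 ++ (t, column m) :: L2).
  by move=> /uL /uniq_support_inj.
have bZ' : bmf (Z' : X N -> R).
  have := bmf_cyls_val (iL t0 erefl) (eq_leq (supL t0 erefl)).
  suff -> : cyls_val (L1 ++ (t0, column m) :: L2) = Z' :> (X N -> R) by [].
  apply/funext => x; rewrite catE /cyl_val indicE mem_set ?mulr1//.
have probE t : item_size t = n -> columns_prob p (l ++ t :: map ray_item r) =
    Ex (p N) (fun x => Z' x * cyl_val (t, column m) x).
  move=> tn; rewrite lE -(cyls_probE _ (iL t tn) (eq_leq (supL t tn))).
  by apply: eq_Ex => x; exact: catE.
pose h (x : X N) : line := nat_code X n (nat_map X (column m) n N x).
have mh : measurable_fun setT h.
  apply: measurableT_comp; first exact: nat_code_measurable.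
  exact: nat_map_measurable.
have mM' : measurable (nat_decode X n @^-1` M : set line).
  by rewrite -[X in measurable X]setTI; exact: nat_decode_measurable.
(* On the sample side the kernel is the Dirac mass at the code read in column [m], so that its value
   on a set is the indicator of the corresponding cylinder. *)
have := @mixed_eq R _ _ _ _ P (p N) Z Z' (fun w => code_kernel n w) (fun x => \d_(h x)) bZ bZ'.
rewrite /mixed => E.
rewrite cat_rcons probE//.
transitivity (Ex P (fun w => Z w * fine (code_kernel n w (nat_decode X n @^-1` M)))).
  apply: eq_Ex => w; rewrite /Z big_rcons /= -!mulrA; congr (_ * _).
  by rewrite mulrC.
rewrite E//.
- apply: eq_Ex => x; congr (_ * _).
  rewrite /dirac /= /cyl_val /= !indicE; congr (nat_of_bool _)%:R.
  by apply/idP/idP; rewrite !inE /= /h nat_codeK.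
- by move=> w; exact: probability_setT.
- by move=> w; change ((\1_[set: line] (h w))%:E = 1%E :> \bar R); rewrite indicE mem_set.
- exact: measurable_code_kernel.
- move=> B mB; rewrite /dirac /=.
  apply/measurable_EFinP.
  exact: (measurableT_comp (measurable_indic mB) mh).
- move=> x; have /= := IH ((n, x) :: r).
  rewrite (probE (ray_item (n, x)))// => e'.
  transitivity (Ex P (fun w => \prod_(t <- l) fine (sample_kernel (item_size t) w (item_set t)) *
    \prod_(a <- (n, x) :: r) fine (code_kernel a.1 w `]-oo, a.2[%classic))).
    by apply: eq_Ex => w; rewrite big_cons /Z /= -mulrA [X in _ * X]mulrC.
  rewrite e'; apply: eq_Ex => y; congr (_ * _).
Qed.

End directing_kernel.

Lemma directing_kernel (R : realType) (X : nat_bds R) (p : nat_exch X) :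
  exists lam : forall n, measurableTypeR R -> probability (X n) R,
  [/\ forall n M, measurable M -> measurable_fun setT (fun w => lam n w M)
    & forall l : seq (item X), Ex (unif01 R)
        (fun w => \prod_(t <- l) fine (lam (item_size t) w (item_set t))) =
      columns_prob p l].
Proof.
have [F [mF F01 F_mono F_out F_joint]] := directing_frequencies p.
exists (sample_kernel X mF F_out); split.
  exact: measurable_sample_kernel.
move=> l; rewrite -[l in RHS]cats0 -[[::]]/(map (@ray_item R X) [::]).
rewrite -(sample_kernel_mixed mF F01 F_mono F_out F_joint).
by apply: eq_Ex => w; rewrite big_nil mulr1.
Qed.

(** * Exchangeability and independence of the directing measures *)

Lemma ae_countable d (T : measurableType d) (R : realType) (P : probability T R)
    (I : countType) (Q : I -> T -> Prop) :
  (forall i, {ae P, forall x, Q i x}) -> {ae P, forall x, forall i, Q i x}.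
Proof.
move=> aeQ.
have := @ae_foralln _ _ _ P (fun n x => if choice.unpickle n is Some i then Q i x else True).
have h : forall n, {ae P, forall x, if choice.unpickle n is Some i then Q i x else True}.
  by move=> n; case: choice.unpickle => [i|]; [exact: aeQ|exact: aeW].
move=> /(_ h); apply: filterS => x hx i.
by have := hx (choice.pickle i); rewrite choice.pickleK.
Qed.

(** * Splitting an event into parts at disjoint positions *)

Section expansions.
Context (R : realType) (X : nat_bds R).
Implicit Types (l : seq (item X)) (L : seq (cylinder X)) (t : item X).

Lemma eq_cyls_prob (p : nat_exch X) L L' : inj_cyls L -> inj_cyls L' ->
  (forall N (x : X N), (sup_support L <= N)%N -> (sup_support L' <= N)%N ->
     cyls_val L x = cyls_val L' x) ->
  cyls_prob p L = cyls_prob p L'.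
Proof.
move=> iL iL' e; pose N := maxn (sup_support L) (sup_support L').
rewrite -(@cyls_probE _ _ p L N)// ?leq_maxl// -(@cyls_probE _ _ p L' N)// ?leq_maxr//.
by apply: eq_Ex => x; apply: e; rewrite ?leq_maxl ?leq_maxr.
Qed.

(* The event t, on a sample of size item_size t, is the joint event L. *)
Definition expansion t L := [/\ uniq (support L), (sup_support L <= item_size t)%N
  & forall y : X (item_size t), \1_(item_set t) y = cyls_val L y].

Definition expansions := seq (item X * seq (cylinder X)).

Fixpoint are_expansions (E : expansions) : Prop :=
  if E is (t, L) :: E' then expansion t L /\ are_expansions E' else True.

Fixpoint spread (cs : seq nat) (E : expansions) : seq (cylinder X) :=
  match cs, E with
  | c :: cs', (t, L) :: E' => map (shift (column c)) L ++ spread cs' E'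
  | _, _ => [::]
  end.

Lemma mem_support_spread cs E x : x \in support (spread cs E) ->
  exists2 c, c \in cs & exists i, x = column c i.
Proof.
elim: cs E => [|c cs IH] [|[t L] E]//=; rewrite support_cat mem_cat => /orP[|/IH[c' c'cs ex]].
  by rewrite shift_support => /mapP[i _ ->]; exists c; rewrite ?mem_head//; exists i.
by exists c' => //; rewrite inE c'cs orbT.
Qed.

Lemma uniq_spread cs E : uniq cs -> are_expansions E -> uniq (support (spread cs E)).
Proof.
elim: cs E => [|c cs IH] [|[t L] E]//= /andP[ccs ucs] [[uL _ _] aE].
rewrite support_cat shift_support cat_uniq IH// andbT; apply/andP; split.
  by rewrite map_inj_uniq// => i j /column_inj[].
apply/hasPn => x /mem_support_spread[c' c'cs [i ->]]; apply/negP => /mapP[j _].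
by move=> /column_inj[e _]; rewrite -e c'cs in ccs.
Qed.

Lemma cyls_val_spread cs E N (x : X N) : are_expansions E ->
  (sup_support (columns cs (map fst E)) <= N)%N ->
  cyls_val (columns cs (map fst E)) x = cyls_val (spread cs E) x.
Proof.
elim: cs E => [|c cs IH] [|[t L] E]//=.
move=> [[uL sL tL] aE] /sup_support_cons[cN EN].
rewrite /cyls_val big_cons big_cat/= -/(cyls_val _ _); congr (_ * _); last exact: IH.
have e : embeds (column c) (item_size t) N.
  apply: (@embeds_cyl _ _ (t, column c)) => //.
  by apply: injective_mkseq_uniq => i j _ _ /column_inj[].
rewrite -/(cyls_val _ x) (cyls_val_shift x _ sL e); last exact: uniq_support_inj.
by rewrite -tL.
Qed.

Lemma map_fst_spread cs E : size cs = size E ->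
  map fst (spread cs E) = flatten [seq map fst tL.2 | tL <- E].
Proof.
elim: cs E => [|c cs IH] [|[t L] E]//= [e].
by rewrite map_cat IH// -map_comp.
Qed.

(** The parts of an event read disjoint positions of its column, so the support stays free of
    repetitions when the event is replaced by its parts; [cyls_prob_columns] then moves each part to
    a column of its own. *)
Lemma columns_prob_expand (p : nat_exch X) E : are_expansions E ->
  columns_prob p (map fst E) = columns_prob p (flatten [seq map fst tL.2 | tL <- E]).
Proof.
move=> aE; set cs := iota 0 (size E).
have ucs : uniq cs by exact: iota_uniq.
rewrite -(@map_fst_spread cs) ?size_iota//.
have uS := uniq_spread ucs aE.
rewrite -cyls_prob_columns//.
rewrite /columns_prob size_map -/cs; apply: eq_cyls_prob.
- exact/uniq_support_inj/uniq_columns.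
- exact: uniq_support_inj.
- by move=> N x sN _; exact: cyls_val_spread.
Qed.

Lemma expansion_id t : expansion t [:: (t, id)].
Proof.
have sE : support [:: (t, id)] = iota 0 (item_size t).
  by rewrite support_cons cats0 /cyl_support /mkseq/= map_id.
split=> [||y]; first by rewrite sE iota_uniq.
  by rewrite /sup_support sE; apply/bigmax_leqP_seq => x; rewrite mem_iota.
rewrite /cyls_val big_seq1 /cyl_val /=.
by rewrite nat_map_id.
Qed.

End expansions.

Section code_rays.
Context (R : realType) (X : nat_bds R) (n : nat).

Definition code_ray (q : rat) : set (X n) := [set x | nat_code X n x < ratr q].

Lemma measurable_code_ray q : measurable (code_ray q).
Proof. exact: measurable_code_lt. Qed.

(** The passage from rational rays to all measurable sets, by [mixed_eq] for the Dirac masses at the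
    codes. The weights [Z], [Z'] allow it to be applied to one factor of a product at a time. *)
Lemma code_rays_eq d (T : measurableType d) d' (T' : measurableType d')
    (P : probability T R) (P' : probability T' R) (Z : T -> R) (Z' : T' -> R)
    (h : T -> X n) (h' : T' -> X n) :
  bmf Z -> bmf Z' -> measurable_fun setT h -> measurable_fun setT h' ->
  (forall q, Ex P (fun x => Z x * \1_(code_ray q) (h x)) =
             Ex P' (fun x => Z' x * \1_(code_ray q) (h' x))) ->
  forall M, measurable M ->
  Ex P (fun x => Z x * \1_M (h x)) = Ex P' (fun x => Z' x * \1_M (h' x)).
Proof.
move=> bZ bZ' mh mh' rays M mM.
have mM' : measurable (nat_decode X n @^-1` M : set (measurableTypeR R)).
  by rewrite -[X in measurable X]setTI; exact: nat_decode_measurable.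
pose c (y : X n) : measurableTypeR R := nat_code X n y.
have := @mixed_eq R _ _ _ _ P P' Z Z' (fun x => \d_(c (h x))) (fun x => \d_(c (h' x))) bZ bZ'.
have codeM (y : X n) : \1_M y =
    fine (\d_(c y) (nat_decode X n @^-1` M)).
  rewrite /dirac /= !indicE; congr (nat_of_bool _)%:R.
  by apply/idP/idP; rewrite !inE /= /c nat_codeK.
rewrite /mixed => E; under eq_Ex do rewrite codeM; under [RHS]eq_Ex do rewrite codeM.
have dT d1 (S : measurableType d1) (g : S -> X n) w :
    \d_(c (g w)) setT = 1%E :> \bar R.
  exact: diracT.
have md d1 (S : measurableType d1) (g : S -> X n) : measurable_fun setT g ->
    forall B : set (measurableTypeR R), measurable B ->
    measurable_fun setT (fun w => \d_(c (g w)) B : \bar R).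
  move=> mg B mB; rewrite /dirac /=; apply/measurable_EFinP.
  apply: (measurableT_comp (measurable_indic mB)).
  exact: (measurableT_comp (@nat_code_measurable R X n) mg).
apply: E => //; [exact: dT|exact: dT|exact: md|exact: md|move=> x].
have cv d1 (S : measurableType d1) (Q : probability S R) (Y : S -> R) (g : S -> X n) :
    bmf Y -> measurable_fun setT g ->
    Ex Q (fun w => Y w * \1_(code_ray (rat_below x k)) (g w)) @[k --> \oo] -->
    Ex Q (fun w => Y w * fine (\d_(c (g w)) `]-oo, x[)).
  move=> [mY [C YC]] mg; apply: (@Ex_cvgT _ _ _ _ _ _ (C * 1)) => [k|k w|w].
  - apply: measurable_funM => //.
    exact: (measurableT_comp (measurable_indic (measurable_code_ray _)) mg).
  - by rewrite normrM ler_pM// indicE ger0_norm// lern1 leq_b1.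
  - apply: cvgMr; apply: cvg_near_cst; rewrite /dirac /= !indicE.
    rewrite /c; set y := nat_code X n (g w); have [yx|yx] := ltP y x.
      have [q] := rat_in_itvoo yx; rewrite in_itv/= => /andP[yq qx].
      have [k0 qk] := rat_below_cofinal qx; exists k0 => // k /= kk0.
      apply/eqP; rewrite !indicE !mem_set//= ?in_itv//=.
      by apply: (lt_le_trans yq); rewrite ler_rat; exact: qk.
    apply: nearW => k; apply/eqP; rewrite !indicE !memNset//= ?in_itv/=.
      by apply/negP; rewrite -leNgt.
    by apply/negP; rewrite -leNgt; apply: (le_trans _ yx); exact/ltW/rat_below_lt.
have := cv _ _ P Z h bZ mh; under eq_fun do rewrite rays.
by move=> /(cvg_unique (@norm_hausdorff _ _)); apply; exact: cv.
Qed.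

End code_rays.

Section directed_laws.
Context (R : realType) (X : nat_bds R).

(** Injections are given by finite sequences and sets by rational rays, so that the conditions are
    countably many and can hold simultaneously almost surely; [rational_exchE] recovers the general
    case. *)
Definition rational_exch (lam : forall n, probability (X n) R) :=
  forall (m n : nat) (s : seq nat) (q : rat), embeds (nth 0%N s) m n ->
    lam n (nat_map X (nth 0%N s) m n @^-1` code_ray q) = lam m (code_ray q).

Definition joint_event n (M N : set (X n)) : set (X (n + n)%N) :=
  nat_map X id n (n + n)%N @^-1` M `&` nat_map X (addn n) n (n + n)%N @^-1` N.

Definition rational_indep (lam : forall n, probability (X n) R) :=
  forall (n : nat) (q r : rat),
    lam (n + n)%N (joint_event (code_ray q) (code_ray r)) =
    (lam n (code_ray q) * lam n (code_ray r))%E.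

Lemma embeds_left n : embeds id n (n + n)%N.
Proof. by apply: embeds_id; rewrite leq_addr. Qed.

Lemma embeds_right n : embeds (addn n) n (n + n)%N.
Proof. by split=> [i|i j _ _ /addnI//]; rewrite ltn_add2l. Qed.

Lemma measurable_nat_map_preimage phi n N (M : set (X n)) : embeds phi n N ->
  measurable M -> measurable (nat_map X phi n N @^-1` M).
Proof.
move=> e mM; rewrite -[X in measurable X]setTI.
exact: (nat_map_measurable e).
Qed.

Lemma measurable_joint_event n (M N : set (X n)) : measurable M -> measurable N ->
  measurable (joint_event M N).
Proof.
move=> mM mN; apply: measurableI.
  exact: measurable_nat_map_preimage (embeds_left n) mM.
exact: measurable_nat_map_preimage (embeds_right n) mN.
Qed.

Lemma rational_exchE lam : rational_exch lam ->
  forall phi m n (M : set (X m)), embeds phi m n -> measurable M ->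
    lam n (nat_map X phi m n @^-1` M) = lam m M.
Proof.
move=> h phi m n M e mM; pose s := mkseq phi m.
have sE i : (i < m)%N -> nth 0%N s i = phi i by move=> im; rewrite nth_mkseq.
have es : embeds (nth 0%N s) m n.
  case: e => e1 e2; split=> [i im|i j im jm]; rewrite ?sE//; [exact: e1|exact: e2].
have ns x : nat_map X phi m n x = nat_map X (nth 0%N s) m n x.
  by apply: nat_map_ext => i im; rewrite sE.
have pre q : Ex (lam n) (fun x => 1 * \1_(code_ray q) (nat_map X phi m n x)) =
    Ex (lam m) (fun x => 1 * \1_(code_ray q) x).
  have mq := @measurable_code_ray R X m q.
  apply: EFin_inj; under eq_Ex do rewrite mul1r ns; under [in RHS]eq_Ex do rewrite mul1r.
  rewrite (Ex_indic _ mq) -(h m n s q es).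
  by rewrite -[RHS]Ex_indic//; exact: measurable_nat_map_preimage.
have := code_rays_eq (bmf_cst _ 1) (bmf_cst _ 1) (nat_map_measurable e)
  (@measurable_id _ _ setT) pre mM.
under eq_Ex do rewrite mul1r; under [in RHS]eq_Ex do rewrite mul1r.
move=> E; rewrite -[RHS]Ex_indic// -E -[LHS]Ex_indic//.
exact: measurable_nat_map_preimage.
Qed.

Lemma rational_indepE lam : rational_indep lam ->
  forall n (M N : set (X n)), measurable M -> measurable N ->
    lam (n + n)%N (joint_event M N) = (lam n M * lam n N)%E.
Proof.
move=> h n M N mM mN.
have mr q := @measurable_code_ray R X n q.
have mleft := @nat_map_measurable R X _ _ _ (embeds_left n).
have mright := @nat_map_measurable R X _ _ _ (embeds_right n).
pose l x := nat_map X id n (n + n)%N x; pose r x := nat_map X (addn n) n (n + n)%N x.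
have jE (A B : set (X n)) : measurable A -> measurable B ->
    lam (n + n)%N (joint_event A B) =
    (Ex (lam (n + n)%N) (fun x => \1_A (l x) * \1_B (r x)))%:E.
  move=> mA mB; rewrite -Ex_indic; last exact: measurable_joint_event.
  by congr EFin; apply: eq_Ex => x; rewrite indicI.
have bl (A : set (X n)) : measurable A -> bmf (fun x => \1_A (l x) : R).
  by move=> mA; exact: (bmf_comp mleft (bmf_indic R mA)).
have br (A : set (X n)) : measurable A -> bmf (fun x => \1_A (r x) : R).
  by move=> mA; exact: (bmf_comp mright (bmf_indic R mA)).
have prodE (A B : set (X n)) : measurable A -> measurable B ->
    (lam n A * lam n B)%E = (Ex (lam n) (fun x => Ex (lam n) \1_A * \1_B x))%:E.
  by move=> mA mB; rewrite ExZ ?EFinM ?Ex_indic//; exact: bmf_indic.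
(* The two rays are replaced in turn, the indicator of the other block serving as weight. *)
have step1 q : lam (n + n)%N (joint_event (code_ray q) N) = (lam n (code_ray q) * lam n N)%E.
  rewrite jE// prodE//; congr EFin.
  apply: (code_rays_eq (bl _ (mr q)) (bmf_cst _ _) mright (@measurable_id _ _ setT)) => // q'.
  by apply: EFin_inj; rewrite -jE// h prodE.
rewrite jE// muleC prodE//; congr EFin.
transitivity (Ex (lam (n + n)%N) (fun x => \1_N (r x) * \1_M (l x))).
  by apply: eq_Ex => x; rewrite mulrC.
apply: (code_rays_eq (br _ mN) (bmf_cst _ _) mleft (@measurable_id _ _ setT)) => // q.
apply: EFin_inj; under eq_Ex do rewrite mulrC.
by rewrite -jE// step1 muleC prodE.
Qed.

Variable p : nat_exch X.
Notation P := (unif01 R).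
Variable lam : forall n, measurableTypeR R -> probability (X n) R.
Hypothesis mlam : forall n M, measurable M -> measurable_fun setT (fun w => lam n w M).
Hypothesis lam_joint : forall l : seq (item X), Ex P
  (fun w => \prod_(t <- l) fine (lam (item_size t) w (item_set t))) = columns_prob p l.

Let value (t : item X) w : R := fine (lam (item_size t) w (item_set t)).

Let value_joint l : Ex P (fun w => \prod_(t <- l) value t w) = columns_prob p l.
Proof. exact: lam_joint. Qed.

Let valueE t w : (value t w)%:E = lam (item_size t) w (item_set t).
Proof. by rewrite fineK// fin_num_measure//; exact: item_measurable. Qed.

Let bvalue t : bmf (value t).
Proof.
apply: bmf01 => [|w].
  by apply: measurableT_comp => //; apply: mlam; exact: item_measurable.
by rewrite -!lee_fin valueE measure_ge0 probability_le1//; exact: item_measurable.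
Qed.

(** The hypotheses equate the three second moments, so the difference has mean square 0. They follow
    from [columns_prob_expand] when [l] lists the parts of [t]. *)
Let ae_eq_prod t l : columns_prob p [:: t; t] = columns_prob p (l ++ l) ->
  columns_prob p (t :: l) = columns_prob p (l ++ l) ->
  {ae P, forall w, value t w = \prod_(t <- l) value t w}.
Proof.
move=> e1 e2; pose D w := (value t w - \prod_(t <- l) value t w) ^+ 2.
have bl : bmf (fun w => \prod_(t <- l) value t w) by exact: bmf_prod.
have bD : bmf D.
  by rewrite /D; under eq_fun do rewrite expr2; apply: bmfM; exact: bmfB.
have DE w : D w = \prod_(t <- [:: t; t]) value t w - 2 * \prod_(t <- t :: l) value t w
    + \prod_(t <- l ++ l) value t w.
  by rewrite /D big_cat !big_cons big_nil /=; ring.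
have D0 : Ex P D = 0.
  rewrite (eq_Ex _ DE) ExD; [|apply: bmfB; last apply: bmfM|]; try exact: bmf_prod.
    rewrite ExB; [|exact: bmf_prod|apply: bmfM; [exact: bmf_cst|exact: bmf_prod]].
    rewrite ExZ; last exact: bmf_prod.
    by rewrite !value_joint e1 e2; ring.
  exact: bmf_cst.
have := Ex_eq0_ae bD (fun w => sqr_ge0 _) D0; apply: filterS => w /eqP.
by rewrite sqrf_eq0 subr_eq0 => /eqP.
Qed.

(** The preimage of a ray under an embedding has a single part, the ray read along that
    embedding. *)
Lemma ae_rational_exch : {ae P, forall w, rational_exch (fun n => lam n w)}.
Proof.
suff : {ae P, forall w, forall i : nat * nat * seq nat * rat,
    embeds (nth 0%N i.1.2) i.1.1.1 i.1.1.2 ->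
    lam i.1.1.2 w (nat_map X (nth 0%N i.1.2) i.1.1.1 i.1.1.2 @^-1` code_ray i.2) =
    lam i.1.1.1 w (code_ray i.2)}.
  by apply: filterS => w h m n s q; exact: (h (m, n, s, q)).
apply: ae_countable => -[[[m n] s] q] /=.
have [e|ne] := pselect (embeds (nth 0%N s) m n); last exact: aeW.
pose tB : item X := Item (@measurable_code_ray R X m q).
pose tA : item X := Item (measurable_nat_map_preimage e (@measurable_code_ray R X m q)).
have eA : expansion tA [:: (tB, nth 0%N s)].
  have us : uniq (mkseq (nth 0%N s) m) by apply: injective_mkseq_uniq; case: (e).
  split=> [||y]; first by rewrite support_cons cats0.
    rewrite /sup_support support_cons cats0; apply/bigmax_leqP_seq => x /mapP[i].
    by rewrite mem_iota add0n => /= im -> _; case: (e) => + _; exact.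
  by rewrite /cyls_val big_seq1.
have eB := expansion_id tB.
have := @ae_eq_prod tA [:: tB].
rewrite /= (@columns_prob_expand _ _ p [:: (tA, _); (tA, _)] (conj eA (conj eA I))).
rewrite (@columns_prob_expand _ _ p [:: (tA, _); (tB, _)] (conj eA (conj eB I))) /=.
move=> /(_ erefl erefl); apply: filterS => w; rewrite big_seq1 => eAB _.
by have := congr1 EFin eAB; rewrite !valueE.
Qed.

(** A joint event has two parts, read at the disjoint blocks of positions 0, ..., n - 1 and n, ...,
    2n - 1. *)
Lemma ae_rational_indep : {ae P, forall w, rational_indep (fun n => lam n w)}.
Proof.
suff : {ae P, forall w, forall i : nat * rat * rat,
    lam (i.1.1 + i.1.1)%N w (joint_event (code_ray i.1.2) (code_ray i.2)) =
    (lam i.1.1 w (code_ray i.1.2) * lam i.1.1 w (code_ray i.2))%E}.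
  by apply: filterS => w h n q r; exact: (h (n, q, r)).
apply: ae_countable => -[[n q] r] /=.
pose tM : item X := Item (@measurable_code_ray R X n q).
pose tN : item X := Item (@measurable_code_ray R X n r).
pose tK : item X := Item (measurable_joint_event (@measurable_code_ray R X n q)
  (@measurable_code_ray R X n r)).
have eK : expansion tK [:: (tM, id); (tN, addn n)].
  have sE : support [:: (tM, id); (tN, addn n)] = iota 0 (n + n).
    rewrite !support_cons cats0 /cyl_support /mkseq/= map_id iotaD; congr (_ ++ _).
    by rewrite -iotaDl addn0.
  split=> [||y]; first by rewrite sE iota_uniq.
    by rewrite /sup_support sE; apply/bigmax_leqP_seq => x; rewrite mem_iota.
  by rewrite /cyls_val big_cons big_seq1 /cyl_val /= /joint_event indicI.
have eM := expansion_id tM; have eN := expansion_id tN.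
have := @ae_eq_prod tK [:: tM; tN].
rewrite /= (@columns_prob_expand _ _ p [:: (tK, _); (tK, _)] (conj eK (conj eK I))).
rewrite (@columns_prob_expand _ _ p [:: (tK, _); (tM, _); (tN, _)]
  (conj eK (conj eM (conj eN I)))) /=.
move=> /(_ erefl erefl); apply: filterS => w; rewrite big_cons big_seq1 => e.
by have := congr1 EFin e; rewrite EFinM !valueE.
Qed.

Lemma Ex_directed n M (mM : measurable M) :
  (Ex P (fun w => fine (lam n w M)))%:E = p n M.
Proof.
pose t : item X := Item mM.
rewrite -[RHS](@cyls_prob1 _ _ p t id); last first.
  by rewrite /cyl_support/= map_inj_uniq ?iota_uniq.
congr EFin; rewrite cyls_prob_columns -?value_joint.
  by apply: eq_Ex => w; rewrite big_seq1.
by rewrite support_cons cats0 /cyl_support/= map_inj_uniq ?iota_uniq.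
Qed.

End directed_laws.

Lemma ergodic_decomposition_nat (R : realType) (X : nat_bds R) (p : nat_exch X) :
  exists lam : forall n, measurableTypeR R -> probability (X n) R,
  [/\ forall n M, measurable M -> measurable_fun setT (fun w => lam n w M),
      forall n M, measurable M -> (Ex (unif01 R) (fun w => fine (lam n w M)))%:E = p n M
    & {ae unif01 R, forall w, rational_exch (fun n => lam n w) /\
        rational_indep (fun n => lam n w)}].
Proof.
have [lam [mlam lam_joint]] := directing_kernel p.
exists lam; split=> // [n M|]; first exact: Ex_directed.
have h := ae_rational_exch mlam lam_joint.
have h' := ae_rational_indep mlam lam_joint.
by apply: filterS2 h h'.
Qed.

(** * Borel data structures along an enumeration *)

Lemma borel_retract (R : realType) d (T : measurableType d) : borel_space R T ->
  exists cd : (T -> R) * (R -> T),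
  [/\ measurable_fun setT cd.1,
      measurable_fun setT (cd.2 : measurableTypeR R -> T),
      forall x, cd.2 (cd.1 x) = x & forall x, 0 <= cd.1 x <= 1].
Proof.
move=> [B [f [mB B01 [fB fI fS] mf mimf]]].
(* Off [B] the inverse is constantly [point], so the preimage of [A] is the image f(A), together
   with the complement of [B] when [A] contains that point. *)
pose dec (y : R) : T := xget point [set x | f x = y].
have decK x : dec (f x) = x.
  rewrite /dec; case: xgetP => [x' _ /= e|/(_ x) /(_ erefl)//].
  by apply: fI; rewrite ?inE.
have f01 x : 0 <= f x <= 1 by have /B01 := fB x I.
exists (f, dec).
split=> /=; [by []| |by []|by []].
move=> _ A mA; rewrite setTI.
rewrite (_ : _ @^-1` _ = (f @` A) `|` (if `[< A point >] then ~` B else set0)).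
  by apply: measurableU; [exact: mimf|case: asboolP => _ //; exact: measurableC].
apply/seteqP; split=> y /=.
  move=> Ay; have [By|nBy] := pselect (B y).
    by left; have [x _ fx] := fS _ By; exists x => //; rewrite -fx decK in Ay.
  right; have e : dec y = point.
    by rewrite /dec; case: xgetP => // x _ /= fx; exfalso; apply: nBy; rewrite -fx; exact: fB.
  by rewrite asboolT// -e.
move=> [[x Ax <-]|]; first by rewrite decK.
case: asboolP => // Ap nBy; rewrite /dec; case: xgetP => // x _ /= fx.
by exfalso; apply: nBy; rewrite -fx; exact: fB.
Qed.

(** * Injections of finite sets as restrictions of total functions *)

Section fset_maps.
Context (R : realType) (U : choiceType) (D : bds R U).
Implicit Types (a b c : {fset U}) (g h : U -> U).

(** Total functions on [U] compose and are compared without dependent types; [bds_mapE] brings any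
    injection [tau] to this form. *)
Definition injects g b a :=
  (forall x, x \in b -> g x \in a) /\ {in b &, injective g}.

Definition restricted g b a (H : injects g b a) (x : b) : a := FSetSub (H.1 (val x) (valP x)).

Lemma restricted_inj g b a (H : injects g b a) : injective (restricted H).
Proof.
move=> x y /(congr1 val) /= e; apply: val_inj.
by apply: H.2 e; exact: valP.
Qed.

Arguments restricted_inj {g b a} H.

(* bds_map along the restriction of g; a dummy unless g injects b into a. *)
Definition fset_map g b a : D a -> D b :=
  match pselect (injects g b a) with
  | left H => bds_map D (restricted_inj H)
  | right _ => fun=> point
  end.
Arguments fset_map : clear implicits.

Lemma eq_bds_map b a (tau tau' : b -> a) (i : injective tau) (i' : injective tau') x :
  tau =1 tau' -> bds_map D i x = bds_map D i' x.
Proof.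
move=> /funext e; subst tau'; congr (bds_map D _ x); exact: Prop_irrelevance.
Qed.

Lemma fset_mapE g b a (H : injects g b a) x :
  fset_map g b a x = bds_map D (restricted_inj H) x.
Proof.
by rewrite /fset_map; case: pselect => [H'|//]; apply: eq_bds_map => y; exact: val_inj.
Qed.

Lemma bds_mapE b a (tau : b -> a) (i : injective tau) g :
  (forall y : b, g (val y) = val (tau y)) ->
  injects g b a /\ forall x, bds_map D i x = fset_map g b a x.
Proof.
move=> e; have H : injects g b a.
  split=> [x xb|x y xb yb]; first by have := valP (tau [` xb]%fset); rewrite -e.
  rewrite (e [` xb]%fset) (e [` yb]%fset) => /val_inj/i/(congr1 val).
  by [].
split=> // x; rewrite (fset_mapE H); apply: eq_bds_map => y.
by apply: val_inj; rewrite /= e.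
Qed.

Lemma fset_map_measurable g b a : injects g b a -> measurable_fun setT (fset_map g b a).
Proof.
move=> H; rewrite (_ : fset_map g b a = bds_map D (restricted_inj H)).
  exact: bds_map_measurable.
by apply/funext => x; exact: fset_mapE.
Qed.

Lemma injects_comp g h c b a : injects g c b -> injects h b a -> injects (h \o g) c a.
Proof.
move=> [g1 g2] [h1 h2]; split=> [x /g1/h1//|x y xc yc /=].
by move=> /(h2 _ _ (g1 _ xc) (g1 _ yc)); exact: g2.
Qed.

Lemma fset_map_comp g h c b a x : injects g c b -> injects h b a ->
  fset_map g c b (fset_map h b a x) = fset_map (h \o g) c a x.
Proof.
move=> Hg Hh; rewrite (fset_mapE Hg) (fset_mapE Hh) -bds_map_comp.
rewrite (fset_mapE (injects_comp Hg Hh)); apply: eq_bds_map => y.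
exact: val_inj.
Qed.

Lemma injects_ext g h b a : {in b, g =1 h} -> injects g b a -> injects h b a.
Proof.
move=> e [g1 g2]; split=> [x xb|x y xb yb]; rewrite -!e//; first exact: g1.
exact: g2.
Qed.

Lemma fset_map_ext g h b a x : {in b, g =1 h} -> fset_map g b a x = fset_map h b a x.
Proof.
move=> e; have [H|nH] := pselect (injects g b a).
  rewrite (fset_mapE H) (fset_mapE (injects_ext e H)); apply: eq_bds_map => y.
  by apply: val_inj; rewrite /= e//; exact: valP.
have nH' : ~ injects h b a.
  by move=> H; apply: nH; apply: injects_ext H => y /e.
by rewrite /fset_map; case: pselect => //; case: pselect.
Qed.

Lemma injects_id b a : (b `<=` a)%fset -> injects id b a.
Proof. by move=> /fsubsetP ba; split. Qed.

Lemma fset_map_id a x : fset_map id a a x = x.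
Proof.
have H := injects_id (fsubset_refl a).
rewrite (fset_mapE H) -[RHS](@bds_map_id _ _ D); apply: eq_bds_map => y.
exact: val_inj.
Qed.

Lemma restrictionE b a (ba : (b `<=` a)%fset) x : @restriction R U D b a ba x = fset_map id b a x.
Proof.
rewrite /restriction (fset_mapE (injects_id ba)); apply: eq_bds_map => y.
by apply: val_inj.
Qed.

Lemma law_fset_map (mu : exch_law D) g b a (M : set (D b)) : injects g b a ->
  measurable M -> mu a (fset_map g b a @^-1` M) = mu b M.
Proof.
move=> H mM; rewrite -(law_exch mu (restricted_inj H) mM); congr (mu a _).
by apply/seteqP; split=> x; rewrite /= (fset_mapE H).
Qed.

End fset_maps.

Arguments fset_map {R U} D g b a x.

(** * Reduction to the initial segments of a sequence *)

Section enumerated_sets.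
Context (R : realType) (U : choiceType) (D : bds R U).
Variable e : nat -> U.
Hypothesis eI : injective e.
Implicit Types (a b c : {fset U}) (phi psi : nat -> nat).

Definition unrank (x : U) : nat := xget 0%N [set i | e i = x].

Lemma unrankK i : unrank (e i) = i.
Proof. by rewrite /unrank; case: xgetP => [j _ /= /eI//|/(_ i)/(_ erefl)]. Qed.

Definition segment n : {fset U} := [fset x in mkseq e n]%fset.

Lemma mem_segment n x : reflect (exists2 i, (i < n)%N & x = e i) (x \in segment n).
Proof.
rewrite /segment inE; apply: (iffP mapP) => [[i]|[i il ->]].
  by rewrite mem_iota add0n => /= il ->; exists i.
by exists i => //; rewrite mem_iota.
Qed.

Lemma e_segment n i : (i < n)%N -> e i \in segment n.
Proof. by move=> il; apply/mem_segment; exists i. Qed.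

Definition lift_map phi (x : U) : U := e (phi (unrank x)).

Lemma lift_mapE phi i : lift_map phi (e i) = e (phi i).
Proof. by rewrite /lift_map unrankK. Qed.

Lemma injects_lift phi n N : embeds phi n N -> injects (lift_map phi) (segment n) (segment N).
Proof.
move=> [p1 p2]; split=> [_ /mem_segment[i il ->]|_ _ /mem_segment[i il ->] /mem_segment[j jl ->]].
  by rewrite lift_mapE; exact/e_segment/p1.
by rewrite !lift_mapE => /eI/p2 ->.
Qed.

Definition seg_code n := projT1 (cid (borel_retract (bds_borel D (segment n)))).

Lemma seg_codeP n : [/\ measurable_fun setT (seg_code n).1,
  measurable_fun setT ((seg_code n).2 : measurableTypeR R -> D (segment n)),
  forall x, (seg_code n).2 ((seg_code n).1 x) = x & forall x, 0 <= (seg_code n).1 x <= 1].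
Proof. exact: (projT2 (cid (borel_retract (bds_borel D (segment n))))). Qed.

Definition seg_map phi n N : D (segment N) -> D (segment n) :=
  fset_map D (lift_map phi) (segment n) (segment N).

Lemma seg_map_id n x : @seg_map id n n x = x.
Proof.
rewrite -[RHS]fset_map_id; apply: fset_map_ext => _ /mem_segment[i il ->].
by rewrite lift_mapE.
Qed.

Lemma seg_map_comp phi psi n N K x : embeds phi n N -> embeds psi N K ->
  seg_map phi n (seg_map psi N x) = @seg_map (psi \o phi) n K x.
Proof.
move=> ep eq; rewrite /seg_map fset_map_comp; [|exact: injects_lift..].
by apply: fset_map_ext => _ /mem_segment[i il ->]; rewrite /= !lift_mapE.
Qed.

Lemma seg_map_ext phi psi n N x : (forall i, (i < n)%N -> phi i = psi i) ->
  seg_map phi n x = @seg_map psi n N x.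
Proof.
move=> h; apply: fset_map_ext => _ /mem_segment[i il ->].
by rewrite !lift_mapE h.
Qed.

Definition seg_bds : nat_bds R := @NatBds R (fun n => bds_disp D (segment n))
  (fun n => D (segment n)) seg_map
  (fun phi n N h => fset_map_measurable (injects_lift h)) seg_map_id
  seg_map_comp seg_map_ext (fun n => (seg_code n).1) (fun n => (seg_code n).2)
  (fun n => let: And4 h _ _ _ := seg_codeP n in h)
  (fun n => let: And4 _ h _ _ := seg_codeP n in h)
  (fun n => let: And4 _ _ h _ := seg_codeP n in h)
  (fun n => let: And4 _ _ _ h := seg_codeP n in h).

Lemma seg_law_map (mu : exch_law D) phi n N (M : set (seg_bds n)) :
  embeds phi n N -> measurable M ->
  mu (segment N) (nat_map seg_bds phi n N @^-1` M) = mu (segment n) M.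
Proof. by move=> ep mM; apply: law_fset_map => //; exact: injects_lift. Qed.

Definition seg_law (mu : exch_law D) : nat_exch seg_bds :=
  @NatExch R seg_bds (fun n => prob_val (mu (segment n))) (@seg_law_map mu).

(** This embeds every finite set into a segment, even one that contains no term of the sequence, so
    that an exchangeable law is determined on segments. *)
Definition rank_map a (x : U) : U := e (index x a).

Lemma injects_rank a n : (#|` a| <= n)%N -> injects (rank_map a) a (segment n).
Proof.
move=> an; split=> [x xa|x y xa ya].
  by apply/e_segment/(leq_trans _ an); rewrite cardfE -cardfE index_mem.
by move=> /eI exy; rewrite -(nth_index x xa) exy nth_index.
Qed.

Definition rank_preimage a n (M : set (D a)) : set (seg_bds n) :=
  fset_map D (rank_map a) a (segment n) @^-1` M.

Arguments rank_preimage {a} n M.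

Lemma measurable_rank_preimage a n (M : set (D a)) : (#|` a| <= n)%N ->
  measurable M -> measurable (rank_preimage n M).
Proof.
move=> an mM; rewrite -[X in measurable X]setTI.
exact: (fset_map_measurable (injects_rank an)).
Qed.

Lemma law_rank_preimage (mu : exch_law D) a n (M : set (D a)) : (#|` a| <= n)%N ->
  measurable M -> mu (segment n) (rank_preimage n M) = mu a M.
Proof. by move=> an mM; apply: law_fset_map => //; exact: injects_rank. Qed.

Lemma exch_law_segments (mu nu : exch_law D) :
  (forall n (M : set (D (segment n))), measurable M -> mu (segment n) M = nu (segment n) M) ->
  mu = nu.
Proof.
move=> h; apply: exch_law_ext => a M mM.
rewrite -(@law_rank_preimage mu a #|` a|)// -(@law_rank_preimage nu a #|` a|)//.
by apply: h; exact: measurable_rank_preimage.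
Qed.

Section law_of_segments.
Variable lam : forall n, probability (seg_bds n) R.
Hypothesis lam_exch : rational_exch lam.

Definition law_of_segments_at a : Prob (D a) R :=
  to_Prob (image_law (lam #|` a|) (fset_map_measurable (injects_rank (leqnn #|` a|)))).

Lemma law_of_segments_atE a (M : set (D a)) : measurable M ->
  law_of_segments_at a M = lam #|` a| (rank_preimage #|` a| M).
Proof. by move=> mM; exact: trimE. Qed.

(** Conjugating [tau] with the rank maps of [b] and [a] gives an embedding of integer segments, to
    which the exchangeability of [lam] applies. *)
Lemma law_of_segments_exch b a (tau : b -> a) (tau_inj : injective tau)
    (M : set (D b)) : measurable M ->
  pushforward (law_of_segments_at a) (bds_map D tau_inj) M = law_of_segments_at b M.
Proof.
move=> mM; rewrite /pushforward !law_of_segments_atE//; last first.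
  by rewrite -[X in measurable X]setTI; exact: bds_map_measurable.
pose g (x : U) : U := if insub x is Some y then val (tau y) else x.
have gE (y : b) : g (val y) = val (tau y) by rewrite /g valK.
have [gI gmap] := bds_mapE D tau_inj gE.
pose phi i := unrank (rank_map a (g (nth (e 0%N) b i))).
have phiE x : x \in b -> e (phi (index x b)) = rank_map a (g x).
  by move=> xb; rewrite /phi nth_index// /rank_map unrankK.
have ra := injects_rank (leqnn #|` a|); have rb := injects_rank (leqnn #|` b|).
have nb i : (i < #|` b|)%N -> nth (e 0%N) b i \in b by exact: mem_nth.
have ephi : embeds phi #|` b| #|` a|.
  split=> [i il|i j il jl].
    have /gI.1/ra.1/mem_segment[k kl rk] := nb i il.
    by rewrite /phi rk unrankK.
  rewrite /phi /rank_map !unrankK => eij.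
  have : nth (e 0%N) b i = nth (e 0%N) b j.
    apply: gI.2; [exact: nb|exact: nb|].
    apply: ra.2; [exact/gI.1/nb|exact/gI.1/nb|].
    by rewrite /rank_map eij.
  by move=> /eqP; rewrite nth_uniq// => /eqP.
rewrite -(rational_exchE lam_exch ephi); last exact: measurable_rank_preimage.
have E x : fset_map D (rank_map b) b (segment #|` b|)
      (nat_map seg_bds phi #|` b| #|` a| x) =
    bds_map D tau_inj (fset_map D (rank_map a) a (segment #|` a|) x).
  have il := injects_lift ephi.
  rewrite gmap (fset_map_comp _ gI ra) (fset_map_comp _ rb il).
  by apply: fset_map_ext => y yb; rewrite /= {1}/rank_map lift_mapE phiE.
by congr (lam _ _); apply/seteqP; split=> x; rewrite /rank_preimage /= E.
Qed.

Definition law_of_segments : exch_law D := ExchLaw law_of_segments_exch.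

(** The finite set [segment n] lists its elements in an order of its own, so its rank map may
    permute the indices; exchangeability of [lam] absorbs the permutation. *)
Lemma law_of_segmentsE n (M : set (seg_bds n)) : measurable M ->
  law_of_segments (segment n) M = lam n M.
Proof.
move=> mM; rewrite /= law_of_segments_atE//.
set k := #|` segment n|.
have rk := injects_rank (leqnn k).
pose phi i := unrank (rank_map (segment n) (e i)).
have ephi : embeds phi n k.
  split=> [i /e_segment/rk.1/mem_segment[j jl h]|i j il jl].
    by rewrite /phi h unrankK.
  rewrite /phi /rank_map !unrankK => h.
  by apply: eI; apply: rk.2; rewrite ?e_segment// /rank_map h.
rewrite -(rational_exchE lam_exch ephi mM); congr (lam _ _).
apply/seteqP; split=> x; rewrite /rank_preimage /= /nat_map /= /seg_map;
  rewrite (@fset_map_ext _ _ D (rank_map (segment n)) (lift_map phi))// => _ /mem_segment[i il ->];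
  by rewrite lift_mapE /phi /rank_map unrankK.
Qed.

End law_of_segments.

Definition segment_indep (mu : exch_law D) :=
  forall n (M N : set (seg_bds n)), measurable M -> measurable N ->
    mu (segment (n + n)%N) (joint_event M N) = (mu (segment n) M * mu (segment n) N)%E.

Lemma rational_indep_segment (mu : exch_law D) :
  rational_indep (seg_law mu) -> segment_indep mu.
Proof. by move=> h n M N mM mN; exact: (rational_indepE h). Qed.

Lemma segment_indep_eSYM (mu : exch_law D) : segment_indep mu -> eSYM D mu.
Proof.
move=> h a b ab M mM.
set c := (a `|` b)%fset; pose n := (#|` a| + #|` b|)%N.
pose f x := (restriction (fsubsetUl a b) x, restriction (fsubsetUr a b) x) : D a * D b.
have mf : measurable_fun setT f.
  by apply/measurable_fun_pairP; split; exact: bds_map_measurable.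
rewrite (@product_measure_unique _ _ _ _ _ (mu a) (mu b) (image_law (mu c) mf))//.
move=> A B mA mB; change (mu c (f @^-1` (A `*` B)) = (mu a A * mu b B)%E).
have -> : f @^-1` (A `*` B) = fset_map D id a c @^-1` A `&` fset_map D id b c @^-1` B.
  by apply/seteqP; split=> x /=; rewrite !restrictionE.
have an : (#|` a| <= n)%N by rewrite leq_addr.
have bn : (#|` b| <= n)%N by rewrite leq_addl.
have iac : injects id a c by apply: injects_id; exact: fsubsetUl.
have ibc : injects id b c by apply: injects_id; exact: fsubsetUr.
(* The set [a] is placed in the first block of [n] positions and [b] in the second; [n] bounds both
   cardinals, so each fits. *)
pose g (x : U) : U := if x \in a then rank_map a x else e (n + index x b)%N.
have bNa x : x \in b -> x \notin a.
  move=> xb; apply/negP => xa; have : x \in (a `&` b)%fset by rewrite inE xa.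
  by rewrite ab inE.
have ga x : x \in a -> g x = rank_map a x by rewrite /g => ->.
have gb x : x \in b -> g x = e (n + index x b)%N by move=> /bNa; rewrite /g => /negbTE ->.
have ra := injects_rank an; have rb := injects_rank bn.
have ia x : x \in a -> (index x a < n)%N.
  by move=> xa; apply: leq_trans an; rewrite -[#|` a|]/(size a) index_mem.
have ib x : x \in b -> (index x b < n)%N.
  by move=> xb; apply: leq_trans bn; rewrite -[#|` b|]/(size b) index_mem.
have gi : injects g c (segment (n + n)%N).
  split=> [x|x y].
    rewrite inE => /orP[xa|xb].
      by rewrite ga//; apply: e_segment; apply: ltn_addr; exact: ia.
    by rewrite gb//; apply: e_segment; rewrite ltn_add2l; exact: ib.
  rewrite !inE => /orP[xa|xb] /orP[ya|yb].
  - by rewrite !ga//; exact: ra.2.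
  - rewrite ga// gb// => /eI exy; have := ia _ xa.
    by rewrite exy ltnNge leq_addr.
  - rewrite gb// ga// => /eI exy; have := ia _ ya.
    by rewrite -exy ltnNge leq_addr.
  - by rewrite !gb// => /eI/addnI exy; apply: rb.2; rewrite // /rank_map exy.
have mA' := measurable_rank_preimage an mA; have mB' := measurable_rank_preimage bn mB.
have mAc : measurable (fset_map D id a c @^-1` A `&` fset_map D id b c @^-1` B).
  apply: measurableI; rewrite -[X in measurable X]setTI.
    exact: (fset_map_measurable iac).
  exact: (fset_map_measurable ibc).
rewrite -(law_fset_map mu gi mAc).
rewrite -(law_rank_preimage mu an mA) -(law_rank_preimage mu bn mB) -h//.
congr (mu _ _); rewrite /joint_event /rank_preimage.
have ea x : fset_map D id a c (fset_map D g c (segment (n + n)%N) x) =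
    fset_map D (rank_map a) a (segment n) (nat_map seg_bds id n (n + n)%N x).
  rewrite fset_map_comp// /nat_map /= /seg_map fset_map_comp//; last first.
    exact/injects_lift/embeds_left.
  by apply: fset_map_ext => y ya; rewrite /= ga// /rank_map lift_mapE.
have eb x : fset_map D id b c (fset_map D g c (segment (n + n)%N) x) =
    fset_map D (rank_map b) b (segment n) (nat_map seg_bds (addn n) n (n + n)%N x).
  rewrite fset_map_comp// /nat_map /= /seg_map fset_map_comp//; last first.
    exact/injects_lift/embeds_right.
  by apply: fset_map_ext => y yb; rewrite /= gb// /rank_map lift_mapE.
by apply/seteqP; split=> x /=; rewrite ea eb.
Qed.

Lemma eSYM_segment_indep (mu : exch_law D) : eSYM D mu -> segment_indep mu.
Proof.
move=> h n M N mM mN.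
(* The second block e n, ..., e (2n - 1) is a copy of the first disjoint from it; the independence
   property is applied to the two blocks after carrying [N] to the copy. *)
set a := segment n; pose b : {fset U} := [fset x in mkseq (e \o addn n) n]%fset.
have mem_b x : reflect (exists2 i, (i < n)%N & x = e (n + i)%N) (x \in b).
  rewrite /b inE; apply: (iffP mapP) => [[i]|[i il ->]].
    by rewrite mem_iota add0n => /= il ->; exists i.
  by exists i => //; rewrite mem_iota.
have ab : (a `&` b)%fset = fset0.
  apply/fsetP => x; rewrite in_fsetI in_fset0; apply/negbTE/negP => /andP[].
  move=> /mem_segment[i il ->] /mem_b[j jl /eI eij].
  by move: il; rewrite eij ltnNge leq_addr.
set c := (a `|` b)%fset; set I := segment (n + n)%N.
have ci : injects id c I.
  split=> // x; rewrite inE => /orP[/mem_segment[i il ->]|/mem_b[i il ->]]; apply: e_segment.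
    exact: ltn_addr.
  by rewrite ltn_add2l.
have iac : injects id a c by apply: injects_id; exact: fsubsetUl.
have ibc : injects id b c by apply: injects_id; exact: fsubsetUr.
have iab : injects (lift_map (addn n)) a b.
  split=> [_ /mem_segment[i il ->]|_ _ /mem_segment[i il ->] /mem_segment[j jl ->]].
    by rewrite lift_mapE; apply/mem_b; exists i.
  by rewrite !lift_mapE => /eI/addnI ->.
pose N' := fset_map D (lift_map (addn n)) a b @^-1` N.
have mN' : measurable N'.
  by rewrite -[X in measurable X]setTI; exact: (fset_map_measurable iab).
have eN : mu b N' = mu a N by exact: law_fset_map iab mN.
have -> : (mu a M * mu a N)%E = (mu a \x mu b)%E (M `*` N').
  by rewrite -eN; apply/esym; exact: product_measure1E.
rewrite -(h a b ab (M `*` N') (measurableX mM mN')).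
rewrite /pushforward.
have -> : (fun x => (restriction (fsubsetUl a b) x, restriction (fsubsetUr a b) x))
    @^-1` (M `*` N') = fset_map D id a c @^-1` M `&` fset_map D id b c @^-1` N'.
  by apply/seteqP; split=> x /=; rewrite !restrictionE.
have mc : measurable (fset_map D id a c @^-1` M `&` fset_map D id b c @^-1` N').
  apply: measurableI; rewrite -[X in measurable X]setTI.
    exact: (fset_map_measurable iac).
  exact: (fset_map_measurable ibc).
rewrite -(law_fset_map mu ci mc); congr (mu _ _); rewrite /joint_event /N'.
have ea x : fset_map D id a c (fset_map D id c I x) = nat_map seg_bds id n (n + n)%N x.
  rewrite fset_map_comp// /nat_map /= /seg_map; apply: fset_map_ext => _ /mem_segment[i il ->].
  by rewrite /= lift_mapE.
have eb x : fset_map D (lift_map (addn n)) a b (fset_map D id b c (fset_map D id c I x)) =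
    nat_map seg_bds (addn n) n (n + n)%N x.
  rewrite (fset_map_comp _ ibc ci) fset_map_comp//; last exact: injects_comp ibc ci.
by apply/seteqP; split=> x /=; rewrite ea eb.
Qed.

(** The independence property is equivalent to countably many equations between evaluations, which
    is the source of the measurability of [eSYM]. *)
Lemma eSYM_rational (mu : exch_law D) : eSYM D mu <-> rational_indep (seg_law mu).
Proof.
split=> [/eSYM_segment_indep h n q r|h].
  by apply: h; exact: measurable_code_ray.
exact/segment_indep_eSYM/rational_indep_segment.
Qed.

End enumerated_sets.

Arguments rank_preimage {R U D e} eI {a} n M _.

(** * The ergodic decomposition *)

Lemma ae_exists d (T : measurableType d) (R : realType) (P : probability T R)
    (Q : T -> Prop) : {ae P, forall x, Q x} -> exists x, Q x.
Proof.
move=> [N [mN N0 QN]]; apply/not_existsP => nQ.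
have : P setT = 0%E.
  rewrite (_ : setT = N)//; apply/seteqP; split=> // x _.
  by apply: QN; exact: nQ.
by rewrite probability_setT => /eqP; rewrite onee_eq0.
Qed.

Lemma Ex_ae_eq d (T : measurableType d) (R : realType) (P : probability T R)
    (f g : T -> R) : bmf f -> bmf g -> {ae P, forall x, f x = g x} -> Ex P f = Ex P g.
Proof.
move=> [mf [M fM]] bg fg.
have h : {ae P, forall x, (fun n : nat => f x) @ \oo --> g x}.
  by apply: filterS fg => x ->; exact: cvg_cst.
have := @Ex_cvg _ _ _ P (fun=> f) g M (fun=> mf) (fun=> fM) bg h.
by move=> /(cvg_lim (@norm_hausdorff _ _)) <-; rewrite lim_cst.
Qed.

Section ergodic_decomposition.
Context (R : realType) (U : choiceType) (D : bds R U).
Variable e : nat -> U.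
Hypothesis eI : injective e.

Notation X := (seg_bds D eI).

Lemma good_law_eSYM (lam : forall n, probability (X n) R)
    (lam_exch : rational_exch lam) : rational_indep lam ->
  eSYM D (law_of_segments lam_exch).
Proof.
move=> lam_indep; apply: (@segment_indep_eSYM _ _ _ e eI) => n M N mM mN.
rewrite !law_of_segmentsE//; first exact: rational_indepE.
exact: measurable_joint_event.
Qed.

(** Almost every directing measure of a given exchangeable law is an element of [eSYM]. *)
Lemma eSYM_neq0 : [set: exch_law D] !=set0 -> eSYM D !=set0.
Proof.
move=> [mu _]; have [lam [_ _ good]] := ergodic_decomposition_nat (seg_law eI mu).
have [w [lam_exch lam_indep]] := ae_exists good.
by exists (law_of_segments lam_exch); exact: good_law_eSYM.
Qed.

Section measurability.
Variable ne : [set: exch_law D] !=set0.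

Lemma measurable_SYM_fine a (M : set (D a)) : measurable M ->
  measurable_fun [set: SYM_space ne] (fun mu : SYM_space ne => fine ((mu : exch_law D) a M)).
Proof. by move=> mM; apply: measurableT_comp => //; exact: measurable_SYM_eval. Qed.

Lemma measurable_eSYM : measurable (eSYM D : set (SYM_space ne)).
Proof.
pose F (i : nat * rat * rat) (mu : SYM_space ne) : R :=
  fine ((mu : exch_law D) (segment e (i.1.1 + i.1.1)%N)
    (joint_event (@code_ray R X i.1.1 i.1.2) (@code_ray R X i.1.1 i.2))) -
  fine ((mu : exch_law D) (segment e i.1.1) (@code_ray R X i.1.1 i.1.2)) *
  fine ((mu : exch_law D) (segment e i.1.1) (@code_ray R X i.1.1 i.2)).
have mF i : measurable_fun setT (F i).
  have mq q := @measurable_code_ray R X i.1.1 q.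
  apply: measurable_funB; first exact: (measurable_SYM_fine (measurable_joint_event (mq _) (mq _))).
  by apply: measurable_funM; apply: measurable_SYM_fine; exact: mq.
rewrite (_ : eSYM D = \bigcap_n (if choice.unpickle n is Some i then F i @^-1` [set 0] else setT)).
  apply: bigcapT_measurable => n; case: choice.unpickle => [i|//].
  by rewrite -[X in measurable X]setTI; apply: mF => //; exact: measurable_set1.
have key mu i : F i mu = 0 <-> (mu : exch_law D) (segment e (i.1.1 + i.1.1)%N)
      (joint_event (@code_ray R X i.1.1 i.1.2) (@code_ray R X i.1.1 i.2)) =
    ((mu : exch_law D) (segment e i.1.1) (@code_ray R X i.1.1 i.1.2) *
     (mu : exch_law D) (segment e i.1.1) (@code_ray R X i.1.1 i.2))%E.
  have mq q := @measurable_code_ray R X i.1.1 q.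
  have f1 : (mu : exch_law D) (segment e (i.1.1 + i.1.1)%N)
      (joint_event (@code_ray R X i.1.1 i.1.2) (@code_ray R X i.1.1 i.2)) \is a fin_num.
    exact: (fin_num_measure _ _ (measurable_joint_event (mq _) (mq _))).
  have f2 q : (mu : exch_law D) (segment e i.1.1) (@code_ray R X i.1.1 q) \is a fin_num.
    exact: (fin_num_measure _ _ (mq q)).
  rewrite /F; split=> [/eqP|->]; last by rewrite fineM// subrr.
  by rewrite subr_eq0 => /eqP h; rewrite -(fineK f1) h EFinM !fineK.
apply/seteqP; split=> mu.
  move=> /(eSYM_rational eI) h n _; case: choice.unpickle => [[[n' q] r]|//].
  by apply/key; exact: h.
move=> h; apply/(eSYM_rational eI) => n q r.
have := h (choice.pickle (n, q, r)) I; rewrite choice.pickleK.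
by move=> /key.
Qed.

End measurability.

Section bijectivity.
Variables (ne : [set: exch_law D] !=set0) (ene : eSYM D !=set0).
Notation space := (eSYM_space ne ene).

Definition eval_at n (M : set (X n)) (nu : space) : R := fine (eSYM_law nu (segment e n) M).

Lemma eSYM_law_eSYM (nu : space) : eSYM D (eSYM_law nu).
Proof. exact: (set_mem (valP (nu : eSYM_pt ene))). Qed.

Lemma bmf_eval a (M : set (D a)) : measurable M ->
  bmf (fun nu : space => fine (eSYM_law nu a M)).
Proof.
move=> mM; apply: bmf01 => [|nu].
  by apply: measurableT_comp => //; exact: measurable_eSYM_eval.
by rewrite -!lee_fin fineK ?fin_num_measure// measure_ge0 probability_le1.
Qed.

Lemma mixtureE (Xi : Prob space R) a (M : set (D a)) : measurable M ->
  mixture Xi a M = (Ex Xi (fun nu => fine (eSYM_law nu a M)))%:E.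
Proof.
move=> mM; rewrite /= mixture_atE// ExE; last exact: bmf_eval.
by apply: eq_integral => nu _; rewrite fineK// fin_num_measure.
Qed.

Let G : set (space -> R) :=
  [set g | exists n (M : set (X n)), measurable M /\ g = eval_at M].

Let bG g : G g -> bmf g.
Proof. by move=> [n [M [mM ->]]]; exact: bmf_eval. Qed.

Let G1 : G (fun=> 1).
Proof.
exists 0%N, setT; split => //; apply/funext => nu.
by rewrite /eval_at probability_setT.
Qed.

Let eval_widen n k (M : set (X n)) : (n <= k)%N -> measurable M ->
  eval_at M = eval_at (nat_map X id n k @^-1` M).
Proof.
move=> nk mM; apply/funext => nu; congr fine.
by rewrite -(seg_law_map (eSYM_law nu) (embeds_id nk) mM).
Qed.

(** Both events are first widened to a common size k, then read on two disjoint blocks of k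
    positions; independence makes the product of the evaluations a single evaluation. *)
Let GM f g : G f -> G g -> G (fun x => f x * g x).
Proof.
move=> [n [M [mM ->]]] [m [N [mN ->]]]; pose k := maxn n m.
have nk : (n <= k)%N by rewrite leq_maxl.
have mk : (m <= k)%N by rewrite leq_maxr.
have mM' := measurable_nat_map_preimage (embeds_id nk) mM.
have mN' := measurable_nat_map_preimage (embeds_id mk) mN.
exists (k + k)%N, (joint_event (nat_map X id n k @^-1` M) (nat_map X id m k @^-1` N)).
split; first exact: measurable_joint_event.
apply/funext => nu; rewrite (eval_widen nk mM) (eval_widen mk mN) /eval_at.
rewrite (eSYM_segment_indep (eSYM_law_eSYM nu) mM' mN').
by rewrite fineM//; apply: fin_num_measure.
Qed.

(** The sets whose indicators are multipliers form a sigma-algebra. It contains the sets where an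
    evaluation exceeds a constant, hence all preimages under evaluations, hence the trace
    sigma-algebra. *)
Lemma mixture_inj : injective (fun Xi : Prob space R => mixture Xi).
Proof.
move=> P Q PQ; apply: Prob_ext => A mA.
have GPQ g : G g -> Ex P g = Ex Q g.
  move=> [n [M [mM ->]]]; apply: EFin_inj.
  by rewrite /eval_at -!mixtureE// PQ.
pose S := [set A : set space | measurable A /\ mult_closure P Q G (\1_A)].
have sS : sigma_algebra setT S by exact: mult_closure_sigma_algebra.
suff : S A by move=> [_]; exact: mult_closure_eq.
have SE n (M : set (X n)) (B : set R) : measurable M -> measurable (B : set (measurableTypeR R)) ->
    S (eval_at M @^-1` B).
  move=> mM mB.
  have Gg : G (eval_at M) by exists n, M.
  have : <<s @RGenOInfty.G R >> B by move: mB; rewrite {1}RGenOInfty.measurableE.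
  have := @smallest_sub _ (sigma_algebra setT) (@RGenOInfty.G R)
    (image_set_system setT (eval_at M) S) (sigma_algebra_image _ sS).
  move=> sub; suff : @RGenOInfty.G R `<=` image_set_system setT (eval_at M) S.
    by move=> /sub/[apply]; rewrite /image_set_system /= setTI.
  move=> _ [x ->]; rewrite /image_set_system /= setTI.
  have -> : eval_at M @^-1` `]x, +oo[ = [set nu | x < eval_at M nu].
    by apply/seteqP; split=> nu; rewrite /= in_itv/= andbT.
  split; last exact/mult_closure_gt/mult_closure_gen.
  rewrite -[X in measurable X]setTI (_ : [set nu | _] = eval_at M @^-1` `]x, +oo[).
    by apply: (bG Gg).1 => //; exact: measurable_itv.
  by apply/seteqP; split=> nu; rewrite /= in_itv/= andbT.
case: mA => C mC <-.
have := @smallest_sub _ (sigma_algebra setT) (evaluation_preimages D)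
  (image_set_system setT (@eSYM_incl _ _ _ ne ene) S) (sigma_algebra_image _ sS).
move=> sub; suff : evaluation_preimages D `<=` image_set_system setT (@eSYM_incl _ _ _ ne ene) S.
  by move=> /sub/(_ C mC).
(* The rank map of [a] turns an evaluation at an arbitrary finite set into one at a segment. *)
move=> _ [a _ [M mM [Y mY <-]]]; rewrite /image_set_system /= !setTI.
pose n := #|` a|.
have mM' := @measurable_rank_preimage _ _ _ _ eI _ _ _ (leqnn n) mM.
rewrite (_ : _ @^-1` _ = eval_at (rank_preimage eI n M) @^-1` (EFin @^-1` Y)).
  by apply: SE => //; rewrite -[X in measurable X]setTI; exact: EFin_measurable.
apply/seteqP; split=> nu; rewrite /= /eval_at fineK ?fin_num_measure//;
  by rewrite law_rank_preimage.
Qed.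

Lemma measurable_eSYM_valued d (T : measurableType d) (L : T -> space) :
  (forall a (M : set (D a)), measurable M -> measurable_fun setT (fun w => eSYM_law (L w) a M)) ->
  measurable_fun setT L.
Proof.
move=> h _ _ [C mC <-]; rewrite setTI setTI.
have : measurable_fun setT (fun w => (@eSYM_incl _ _ _ ne ene (L w) : SYM_space ne)).
  apply: (@measurability _ _ T (SYM_space ne) setT _ (evaluation_preimages D)) => //.
  move=> _ [_ [a _ [M mM [Y mY <-]]] <-]; rewrite !setTI.
  by have := h a M mM measurableT Y mY; rewrite setTI.
by move=> /(_ measurableT C mC); rewrite setTI.
Qed.

Lemma mixture_surj (mu : exch_law D) : exists Xi : Prob space R, mixture Xi = mu.
Proof.
have [lam [mlam lam_mean [N [mN N0 good]]]] := ergodic_decomposition_nat (seg_law eI mu).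
have goodN w : ~ N w -> rational_exch (fun n => lam n w) /\ rational_indep (fun n => lam n w).
  by move=> nNw; apply: contrapT => bad; apply: nNw; exact: good.
pose nu0 : exch_law D := projT1 (cid ene).
have nu0_eSYM : eSYM D nu0 by exact: (projT2 (cid ene)).
(* On the null set [N], outside which [lam] is known to be exchangeable and independent, a fixed law
   of [eSYM] is taken, so that [K] has values in [eSYM] everywhere; it remains measurable because
   [N] is measurable. *)
pose K w : exch_law D :=
  match pselect (N w) with
  | left _ => nu0
  | right h => law_of_segments (goodN w h).1
  end.
have K_eSYM w : eSYM D (K w).
  rewrite /K; case: pselect => // h.
  exact: good_law_eSYM (goodN w h).2.
have KE n (M : set (X n)) w : measurable M -> ~ N w -> K w (segment e n) M = lam n w M.
  by move=> mM nNw; rewrite /K; case: pselect => // h; exact: law_of_segmentsE.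
have mK a (M : set (D a)) : measurable M -> measurable_fun setT (fun w => K w a M).
  move=> mM; pose M' := rank_preimage eI #|` a| M.
  have mM' : measurable M' by exact: measurable_rank_preimage.
  rewrite (_ : (fun w => _) = fun w => if w \in N then nu0 a M else lam #|` a| w M').
    apply: measurable_fun_ifT => //; last exact: mlam.
    apply: (measurable_fun_bool true); rewrite setTI.
    rewrite (_ : _ @^-1` _ = N)//; apply/seteqP; split=> w /=; first by move=> /set_mem.
    by move=> Nw; rewrite mem_set.
  apply/funext => w; case: ifPn => [/set_mem Nw|/negP nNw].
    by rewrite /K; case: pselect.
  have {}nNw : ~ N w by move=> /mem_set.
  by rewrite -KE// law_rank_preimage.
pose L w : space := exist (fun nu => nu \in eSYM D) (K w) (mem_set (K_eSYM w)).
have mL : measurable_fun setT L by exact: measurable_eSYM_valued.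
exists (to_Prob (image_law (unif01 R) mL)).
apply: (exch_law_segments eI) => n M mM; rewrite mixtureE//.
rewrite -[RHS](lam_mean n M mM); congr EFin.
rewrite (_ : Ex _ _ = Ex (image_law (unif01 R) mL) (fun nu => fine (eSYM_law nu (segment e n) M))).
  rewrite Ex_image_law; last exact: bmf_eval.
  have bl : bmf (fun w => fine (lam n w M)).
    apply: bmf01 => [|w]; first by apply: measurableT_comp => //; exact: mlam.
    by rewrite -!lee_fin fineK ?fin_num_measure// measure_ge0 probability_le1.
  apply: Ex_ae_eq => //; first exact: (bmf_comp mL (bmf_eval mM)).
  exists N; split=> // w /= h; apply: contrapT => nNw; apply: h.
  by congr fine; exact: KE.
by apply: eq_Ex_measure => A mA; exact: trimE.
Qed.

Lemma mixture_bij : bijective (fun Xi : Prob space R => mixture Xi).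
Proof.
have h mu := cid (mixture_surj mu).
exists (fun mu => projT1 (h mu)) => [Xi|mu]; last exact: (projT2 (h mu)).
by apply: mixture_inj; exact: (projT2 (h _)).
Qed.

End bijectivity.
End ergodic_decomposition.

Theorem theorem1 (R : realType) (U : choiceType)
    (U_infinite : infinite_set [set: U])
    (D : bds R U) (ne : [set: exch_law D] !=set0) :
  [/\ eSYM D !=set0,
      measurable (eSYM D : set (SYM_space ne))
    & forall ene : eSYM D !=set0,
        bijective (fun Xi : Prob (eSYM_space ne ene) R => mixture Xi) ].
Proof.
have [e eI] : exists e : nat -> U, injective e.
  have /infiniteP/card_leP[f] := U_infinite.
  exists (fun n => val (f (SigSub (mem_set (I : [set: nat] n))))) => m n /val_inj.
  by move=> /(inj (mem_set I) (mem_set I)) /(congr1 val).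
split=> [||ene]; [exact: eSYM_neq0 eI ne|exact: measurable_eSYM eI ne|].
exact: mixture_bij eI ne ene.
Qed.
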